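(* For every natural number $n\geq 8$, the cost of edge-distinguishing $\rho'(K_n)$ of the complete graph $K_n$ equals the number of red edges of an almost spanning asymmetric forest produced by Procedure P (described in the context). In particular, for $n\geq 8$, $$\rho'(K_{n}) = n-\sum_{i=1}^{N} a_{i} - w,$$ where $a_i$ is the number of (isomorphism classes of) asymmetric trees with $i$ vertices, and the integers $N$, $w$ are defined by $$\sum_{i=1}^{N} i a_i \leq n < \sum_{i=1}^{N+1} i a_{i}, \qquad n=\sum_{i=1}^{N} i a_{i} + w(N+1)+r,\quad 0\leq w<a_{N+1},\quad 0\leq r<N+1 .$$
   Context: A graph is asymmetric if its only automorphism is the identity; the one-vertex tree is asymmetric (so $a_1=1$), and the smallest asymmetric tree with more than one vertex has $7$ vertices. An edge coloring of a graph $G$ is distinguishing if no automorphism of $G$ other than the identity preserves it. The distinguishing index $D'(G)$ is the least number of colors in a distinguishing edge coloring. When $D'(G)=2$ (this holds for $K_n$ with $n\ge 6$), the cost of edge-distinguishing (edge-cost) $\rho'(G)$ is the least number of edges in the smaller of the two color classes, over all distinguishing edge colorings of $G$ with two colors. Let $\Omega=\{T_1,T_2,\ldots\}$ be a list of the asymmetric trees with more than one vertex, each isomorphism class listed once, with $|T_j|\ge |T_i|$ (number of vertices) whenever $j>i$. Procedure P, for $K_n$ with $n\ge 8$ (initially all vertices are available): Step 1. Choose a vertex of $K_n$ and remove it from the set of available vertices. Step 2. Take the first tree $T_i$ of $\Omega$ not already used. Choose $|T_i|$ available vertices and color red some edges of the subgraph they induce so that the red edges form a graph isomorphic to $T_i$.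 Remove the chosen vertices from the set of available vertices. Step 3. If the number of available vertices is at least the number of vertices of the first tree of $\Omega$ not already used, go to Step 2. Otherwise, if the number of available vertices is zero, go to Step 4; if it is not zero, delete the last chosen red asymmetric tree, put its vertices back into the set of available vertices, choose from $\Omega$ a tree $T^\ast$ having exactly as many vertices as are available, color red some edges of the subgraph induced by the available vertices so that the red edges form a graph isomorphic to $T^\ast$, and go to Step 4. Step 4. Color all remaining edges blue. The forest produced by the procedure is the graph formed by the red edges; it covers all vertices except the one removed in Step 1 (''almost spanning''). *)

(* Defs.v *)
From HB Require Import structures.
From mathcomp Require Import all_boot all_fingroup.

Set Implicit Arguments.
Unset Strict Implicit.
Unset Printing Implicit Defensive.

Record graph (V : finType) := Graph {
  edges : {set {set V}};
  edges_card2 : [forall e in edges, #|e| == 2]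
}.

HB.instance Definition _ (V : finType) := [isSub for @edges V].
HB.instance Definition _ (V : finType) := [Finite of graph V by <:].

Lemma complete_card2 (V : finType) :
  [forall e in [set e : {set V} | #|e| == 2], #|e| == 2].
Proof. by apply/forall_inP => e; rewrite inE. Qed.

Definition complete (V : finType) : graph V := Graph (complete_card2 V).

Definition adj (V : finType) (G : graph V) : rel V :=
  fun x y => [set x; y] \in edges G.

(* The graph with vertex set S and edge set F, living inside the ambient
   vertex type V, is isomorphic to T. *)
Definition is_copy (W V : finType) (T : graph W)
    (S : {set V}) (F : {set {set V}}) : bool :=
  [exists f : {ffun W -> V},
    [&& injectiveb f, S == f @: [set: W]
      & F == [set f @: (e : {set W}) | e in edges T]]].

Definition isomorphic (V W : finType) (G : graph V) (H : graph W) : bool :=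
  is_copy G [set: W] (edges H).

Definition automorphism (V : finType) (G : graph V) (p : {perm V}) : bool :=
  [set p @: (e : {set V}) | e in edges G] == edges G.

Definition asymmetric (V : finType) (G : graph V) : bool :=
  [forall p : {perm V}, automorphism G p ==> (p == 1%g)].

(* A cycle has pairwise distinct vertices, hence length at most #|V|; bounding
   the length keeps the predicate boolean. *)
Definition forest (V : finType) (G : graph V) : bool :=
  [forall k : 'I_#|V|.+1, forall s : k.-tuple V,
    (2 < k) ==> ~~ ucycleb (adj G) s].

Definition connected (V : finType) (G : graph V) : bool :=
  (0 < #|V|) && [forall x, forall y, connect (adj G) x y].

Definition tree (V : finType) (G : graph V) : bool :=
  connected G && forest G.

Definition num_asym_trees (i : nat) : nat :=
  #|equivalence_partition (@isomorphic 'I_i 'I_i)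
      [set G : graph 'I_i | tree G && asymmetric G]|.

Definition edge (V : finType) (G : graph V) : finType :=
  {e : {set V} | e \in edges G}.

Definition edge_coloring (V : finType) (G : graph V) (k : nat) : finType :=
  {ffun edge G -> 'I_k}.

Definition preserves (V : finType) (G : graph V) (k : nat)
    (p : {perm V}) (c : edge_coloring G k) : bool :=
  [forall e : edge G, forall e' : edge G,
    (val e' == p @: val e) ==> (c e' == c e)].

Definition distinguishing (V : finType) (G : graph V) (k : nat)
    (c : edge_coloring G k) : bool :=
  [forall p : {perm V}, automorphism G p && preserves p c ==> (p == 1%g)].

Definition is_least (P : nat -> Prop) (m : nat) : Prop :=
  P m /\ forall k, P k -> m <= k.

(* D'(G) = k; relational because some graphs, such as K_2, have no
   distinguishing edge coloring. *)
Definition is_dist_index (V : finType) (G : graph V) (k : nat) : Prop :=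
  is_least (fun k => exists c : edge_coloring G k, distinguishing c) k.

Definition color_class (V : finType) (G : graph V) (k : nat)
    (c : edge_coloring G k) (i : 'I_k) : {set edge G} :=
  [set e | c e == i].

(* rho'(G) = m; the cost is only defined when D'(G) = 2. *)
Definition is_edge_cost (V : finType) (G : graph V) (m : nat) : Prop :=
  is_dist_index G 2 /\
  is_least (fun k => exists2 c : edge_coloring G 2, distinguishing c
    & k = minn #|color_class c ord0| #|color_class c ord_max|) m.

(* Omega = (T_0, T_1, ...), numbered from 0; T_j lives on sz j vertices. *)
Definition asym_tree_list (sz : nat -> nat) (T : forall j, graph 'I_(sz j)) :
    Prop :=
  [/\ forall j, [/\ 1 < sz j, tree (T j) & asymmetric (T j)],
      forall m (G : graph 'I_m), 1 < m -> tree G -> asymmetric G ->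
        exists! j, isomorphic G (T j)
    & forall i j, i < j -> sz i <= sz j].

(* [reached T c A]: Step 1 and size c executions of Step 2 have been carried
   out, A is the set of available vertices, and c lists the vertex sets and red
   edge sets of the colored trees, the last one first.  The first unused tree is
   therefore T (size c), and S \subset A holds for a suitable S only if enough
   vertices are available. *)
Inductive reached (sz : nat -> nat) (T : forall j, graph 'I_(sz j))
    (V : finType) : seq ({set V} * {set {set V}}) -> {set V} -> Prop :=
| Step1 (v : V) : reached T [::] [set~ v]
| Step2 (c : seq ({set V} * {set {set V}})) (A S : {set V})
    (F : {set {set V}}) :
    reached T c A -> S \subset A -> is_copy (T (size c)) S F ->
    reached T ((S, F) :: c) (A :\: S).

Definition red_edges (V : finType) (c : seq ({set V} * {set {set V}})) :
    {set {set V}} :=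
  \bigcup_(p <- c) p.2.

(* [produced T G]: some run of the procedure ends with G as its red graph,
   either with no vertex left over, or after replacing the last tree. *)
Inductive produced (sz : nat -> nat) (T : forall j, graph 'I_(sz j))
    (V : finType) (G : graph V) : Prop :=
| NoneLeft (c : seq ({set V} * {set {set V}})) :
    reached T c set0 -> edges G = red_edges c -> produced T G
| ReplaceLast (S : {set V}) (F : {set {set V}})
    (c : seq ({set V} * {set {set V}})) (A : {set V}) (j : nat)
    (F' : {set {set V}}) :
    reached T ((S, F) :: c) A ->
    #|A| < sz (size ((S, F) :: c)) -> A != set0 ->
    sz j = #|A :|: S| -> is_copy (T j) (A :|: S) F' ->
    edges G = red_edges ((A :|: S, F') :: c) -> produced T G.

Definition decomposition (n N w r : nat) : Prop :=
  [/\ \sum_(1 <= i < N.+1) i * num_asym_trees i <= n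
        < \sum_(1 <= i < N.+2) i * num_asym_trees i,
      n = \sum_(1 <= i < N.+1) i * num_asym_trees i + w * N.+1 + r,
      w < num_asym_trees N.+1
    & r < N.+1].

(* Main.v *)
(* A two-coloring of K_n is distinguishing iff either color class is an
   asymmetric graph, so the edge cost is the least number of edges of an
   asymmetric graph on n vertices.  A connected graph on m vertices has at least
   m - 1 edges, with equality only for trees; hence a graph on n vertices has at
   least n - t edges, t being the number of its components that are trees.  In an
   asymmetric graph these components are pairwise non-isomorphic asymmetric
   trees, so t is at most the largest number of initial terms in a list of all
   asymmetric trees by size whose total size is at most n.  The greedy procedure
   attains this bound; its last step needs an asymmetric tree of each size
   m >= 7 (a spider with legs of lengths 1, 2 and m - 4) and the fact that no
   asymmetric tree has 2 to 6 vertices (a finite check). *)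
Require Import Defs.
From HB Require Import structures.
From mathcomp Require Import all_boot all_fingroup.
From mathcomp Require Import zify.

Set Implicit Arguments.
Unset Strict Implicit.
Unset Printing Implicit Defensive.

(** Upper and lower bound agree only if the vertex removed in Step 1 counts as the one-vertex tree.
    A list [Omega] omits that tree, whence the [1 +] in front of the sums of sizes. Placing trees
    greedily may leave several vertices over, and these would be pairwise exchangeable isolated
    vertices. Absorbing them into the last tree keeps the number of trees, hence the number of
    edges, and the new tree differs from all earlier ones because it is larger. Its size is at least
    that of the deleted tree, so at least 7, and a spider of that size exists. To treat both endings
    of the procedure alike, [packing] requires only distinct indices, not consecutive ones. The
    closed formula mentions no list. It is obtained from one explicit list made of class
    representatives, in which number 0 would be the one-vertex tree. *)

(** * Adjacency and isomorphism *)

Section Adjacency.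

Variable V : finType.
Implicit Types (G H : graph V) (p : {perm V}).

Lemma adjC G : symmetric (adj G).
Proof. by move=> x y; rewrite /adj setUC. Qed.

Lemma card_edge G e : e \in edges G -> #|e| = 2.
Proof. by move=> eG; apply/eqP; exact: (forall_inP (edges_card2 G)). Qed.

Lemma adj_neq G x y : adj G x y -> x != y.
Proof. by move/card_edge/eqP; rewrite cards2; case: (x != y). Qed.

Lemma edgeP G (e : {set V}) :
  reflect (exists x y, e = [set x; y] /\ adj G x y) (e \in edges G).
Proof.
apply: (iffP idP) => [eG | [x [y [-> xy]]]]; last exact: xy.
by have /eqP/cards2P[x [y [_ eE]]] := card_edge eG; exists x, y; rewrite /adj -eE.
Qed.

Lemma imset_set2 (W : finType) (f : V -> W) x y :
  f @: [set x; y] = [set f x; f y].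
Proof. by rewrite imsetU1 imset_set1. Qed.

Lemma sub_edges G (E : {set {set V}}) :
  (forall x y, adj G x y -> [set x; y] \in E) -> edges G \subset E.
Proof. by move=> sub; apply/subsetP=> e /edgeP[x [y [-> /sub]]]. Qed.

(** The image of the edge set has the same cardinality as the edge set, so an inclusion between the
    two is already an equality. *)
Lemma automorphismP G p :
  reflect (forall x y, adj G x y -> adj G (p x) (p y)) (automorphism G p).
Proof.
have cardE : #|[set p @: (e : {set V}) | e in edges G]| = #|edges G|.
  by apply: card_imset; apply: imset_inj; apply: perm_inj.
apply: (iffP eqP) => [autp x y xy | autp].
  by rewrite /adj -imset_set2 -autp imset_f.
apply/eqP; rewrite eqEcard cardE leqnn andbT.
by apply/subsetP=> _ /imsetP[_ /edgeP[x [y [-> xy]]] ->]; rewrite imset_set2; apply: autp.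
Qed.

Lemma automorphism_adj G p x y :
  automorphism G p -> adj G (p x) (p y) = adj G x y.
Proof.
move=> autp; apply/idP/idP; last by move: x y; apply/automorphismP.
rewrite /adj -imset_set2 -{1}(eqP autp) mem_imset //.
by apply: imset_inj; apply: perm_inj.
Qed.

Lemma automorphismV G p : automorphism G p -> automorphism G p^-1%g.
Proof.
move=> autp; apply/automorphismP=> x y xy.
by rewrite -(automorphism_adj _ _ autp) !permKV.
Qed.

End Adjacency.

Lemma is_copyP (W V : finType) (T : graph W) (S : {set V}) (F : {set {set V}}) :
  reflect (exists f : W -> V, [/\ injective f, S = f @: [set: W]
             & F = [set f @: (e : {set W}) | e in edges T]])
          (is_copy T S F).
Proof.
apply: (iffP existsP) => [[f /and3P[/injectiveP finj /eqP-> /eqP->]] | [f [finj -> ->]]].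
  by exists f.
have fE : finfun f =1 f by move=> x; rewrite ffunE.
exists (finfun f); apply/and3P; split.
- by apply/injectiveP=> x y; rewrite !fE; apply: finj.
- by rewrite (eq_imset _ fE).
- by apply/eqP; apply: eq_imset => e; rewrite (eq_imset _ fE).
Qed.

Lemma mem_copy_edges (W V : finType) (T : graph W) (f : W -> V) x y :
  injective f ->
  ([set f x; f y] \in [set f @: (e : {set W}) | e in edges T]) = adj T x y.
Proof. by move=> finj; rewrite -imset_set2 mem_imset //; apply: imset_inj. Qed.

Lemma isomorphicP (V W : finType) (G : graph V) (H : graph W) :
  reflect (exists h : V -> W,
             bijective h /\ forall x y, adj H (h x) (h y) = adj G x y)
          (isomorphic G H).
Proof.
apply: (iffP (is_copyP _ _ _)) => [[h [hinj hT hE]] | [h [hbij hadj]]].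
  exists h; split=> [|x y]; last by rewrite -(mem_copy_edges G x y hinj) -hE.
  apply: inj_card_bij => //.
  by rewrite -!cardsT hT leq_imset_card.
have [hinj [g hK gK]] := (bij_inj hbij, hbij).
exists h; split=> //.
  by apply/setP=> y; rewrite inE; apply/esym/imsetP; exists (g y); rewrite ?gK.
apply/eqP; rewrite eqEsubset; apply/andP; split.
  by apply: sub_edges => x y xy; rewrite -[x]gK -[y]gK mem_copy_edges // -hadj !gK.
by apply/subsetP=> _ /imsetP[_ /edgeP[x [y [-> xy]]] ->]; rewrite imset_set2 -/(adj _ _ _) hadj.
Qed.

Lemma isomorphic_refl (V : finType) (G : graph V) : isomorphic G G.
Proof. by apply/isomorphicP; exists id; split=> //; exists id. Qed.

Lemma isomorphic_sym (V W : finType) (G : graph V) (H : graph W) :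
  isomorphic G H -> isomorphic H G.
Proof.
case/isomorphicP=> h [[g hK gK] hadj]; apply/isomorphicP; exists g; split.
  by exists h.
by move=> x y; rewrite -hadj !gK.
Qed.

Lemma isomorphic_trans (U V W : finType)
    (H : graph V) (G : graph U) (K : graph W) :
  isomorphic G H -> isomorphic H K -> isomorphic G K.
Proof.
case/isomorphicP=> h [hbij hadj] /isomorphicP[k [kbij kadj]].
apply/isomorphicP; exists (k \o h); split; first exact: bij_comp.
by move=> x y; rewrite kadj hadj.
Qed.

Lemma isomorphic_card (V W : finType) (G : graph V) (H : graph W) :
  isomorphic G H -> #|V| = #|W|.
Proof. by case/isomorphicP=> h [/bij_eq_card]. Qed.

Section CopyTheory.

Variables (W V : finType) (T : graph W) (S : {set V}) (F : {set {set V}}).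
Hypothesis TSF : is_copy T S F.

Lemma card_copy : #|S| = #|W|.
Proof. by have /is_copyP[f [finj -> _]] := TSF; rewrite card_imset ?cardsT. Qed.

Lemma card_copy_edges : #|F| = #|edges T|.
Proof.
by have /is_copyP[f [finj _ ->]] := TSF; rewrite card_imset //; apply: imset_inj.
Qed.

Lemma copy_edge_card2 e : e \in F -> #|e| = 2.
Proof.
have /is_copyP[f [finj _ ->]] := TSF.
by case/imsetP=> e' /card_edge <- ->; rewrite card_imset.
Qed.

Lemma copy_edge_sub e : e \in F -> e \subset S.
Proof.
have /is_copyP[f [finj -> ->]] := TSF.
by case/imsetP=> e' _ ->; apply/imsetS/subsetT.
Qed.

End CopyTheory.

Lemma exists_copy (m : nat) (V : finType) (T : graph 'I_m) (S : {set V}) :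
  #|S| = m -> exists F, is_copy T S F.
Proof.
move=> Sm; subst m; pose f (i : 'I_#|S|) := enum_val i.
exists [set f @: (e : {set 'I_#|S|}) | e in edges T].
apply/is_copyP; exists f; split=> //; first exact: enum_val_inj.
apply/setP=> x; apply/idP/imsetP=> [xS | [i _ ->]]; last exact: enum_valP.
by exists (enum_rank_in xS x); rewrite // /f enum_rankK_in.
Qed.

Lemma isomorphic_card1 (V W : finType) (G : graph V) (H : graph W) :
  #|V| = 1 -> #|W| = 1 -> isomorphic G H.
Proof.
move=> /fintype1[v vE] /fintype1[w wE].
apply/isomorphicP; exists (fun=> w); split.
  by exists (fun=> v) => x; rewrite ?vE ?wE.
move=> x y; apply/idP/idP => /adj_neq; first by rewrite eqxx.
by rewrite (vE x) (vE y) eqxx.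
Qed.

(** * Trees and parent functions *)

Section Trees.

Variables (V : finType) (G : graph V).

Lemma forestP :
  reflect (forall s : seq V, 2 < size s -> ~~ ucycleb (adj G) s) (forest G).
Proof.
apply: (iffP forallP) => [acyc s s3 | acyc k]; last first.
  by apply/forallP=> s; apply/implyP=> k3; apply: acyc; rewrite size_tuple.
apply/negP=> /[dup] scyc /andP[_ us].
have szs : size s < #|V|.+1 by rewrite ltnS -(card_uniqP us) max_card.
have := forallP (acyc (Ordinal szs)) (in_tuple s).
by rewrite s3 scyc.
Qed.

(* The largest value of [d] on a cycle would be taken at a vertex whose two
   neighbours on the cycle are both its parent. *)
Lemma forest_parent (d : V -> nat) (pi : V -> V) :
  (forall x y, adj G x y ->
     d y < d x /\ y = pi x \/ d x < d y /\ x = pi y) -> forest G.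
Proof.
move=> par; apply/forestP=> s s3; apply/negP=> /andP[scyc us].
have [x0 x0s] : exists x0, x0 \in s.
  by case: s s3 {scyc us} => // a s _; exists a; rewrite mem_head.
case: (@arg_maxnP _ x0 (mem s) d x0s) => x xs xmax.
have [i s' sE] := rot_to xs.
have s'max y : y \in s' -> d y <= d x.
  by move=> ys'; apply: xmax; rewrite /= -(mem_rot i) sE inE ys' orbT.
move: s3 scyc us; rewrite -(size_rot i) -(rot_cycle i) -(rot_uniq i) sE.
case: s' => // y s' in s'max sE *; case/lastP: s' => // s' z in s'max sE *.
move=> _ /= /andP[xy]; rewrite rcons_path last_rcons => /andP[_ zx].
have dy : d y <= d x by apply: s'max; rewrite mem_head.
have dz : d z <= d x by apply: s'max; rewrite inE mem_rcons mem_head orbT.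
have -> : y = pi x by case: (par _ _ xy) => [[]|[]] //; lia.
have -> : z = pi x by case: (par _ _ zx) => [[]|[]] //; lia.
by rewrite mem_rcons mem_head andbF.
Qed.

Lemma connected_parent (r : V) (d : V -> nat) (pi : V -> V) :
  (forall x, x != r -> adj G x (pi x) /\ d (pi x) < d x) -> connected G.
Proof.
move=> par; apply/andP; split; first by apply/card_gt0P; exists r.
have toroot x : connect (adj G) x r.
  have [n] := ubnP (d x); elim: n x => // n IHn x; rewrite ltnS => dx.
  have [-> // | /par[xpi dpi]] := eqVneq x r.
  by apply: connect_trans (connect1 xpi) (IHn _ _); apply: leq_trans dpi dx.
apply/forallP=> x; apply/forallP=> y; apply: connect_trans (toroot x) _.
by rewrite (sym_connect_sym (@adjC _ G)).
Qed.

Hypothesis Gconn : connected G.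

(** Here [d] is the distance to [r], and [pi x] is the last vertex before [x] on a shortest walk
    from [r]. *)
Lemma exists_parent :
  exists (r : V) (d : V -> nat) (pi : V -> V),
    forall x, x != r -> adj G x (pi x) /\ d (pi x) < d x.
Proof.
have /andP[/card_gt0P[r _] /forallP/(_ r)/forallP conn_r] := Gconn.
pose walk x k := [exists p : k.-tuple V, path (adj G) r p && (last r p == x)].
have walkI p : path (adj G) r p -> walk (last r p) (size p).
  by move=> rp; apply/existsP; exists (in_tuple p); rewrite rp eqxx.
have ex_walk x : exists k, walk x k.
  by have /connectP[p rp ->] := conn_r x; exists (size p); apply: walkI.
pose d x := ex_minn (ex_walk x); exists r, d.
suff: forall x, exists y, x != r -> adj G x y /\ d y < d x.
  by case/fin_all_exists=> pi pi_par; exists pi.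
move=> x; rewrite /d; case: (ex_minnP (ex_walk x)) => k.
case/existsP=> [[p /= /eqP pk] /andP[rp /eqP px]] _.
case/lastP: p => [|p y] in pk rp px; first by exists x; rewrite -px eqxx.
move: rp px; rewrite rcons_path last_rcons => /andP[rp yx] <-.
exists (last r p) => _; split; first by rewrite adjC.
case: ex_minnP => l _ /(_ _ (walkI _ rp)) /leq_ltn_trans; apply.
by rewrite -pk size_rcons.
Qed.

(** The parent edges alone connect everything. Any other edge [x y] would close a simple path of
    parent edges to a cycle of length at least 3. *)
Lemma tree_edge_parent (r : V) (d : V -> nat) (pi : V -> V) x y :
  (forall x, x != r -> adj G x (pi x) /\ d (pi x) < d x) ->
  forest G -> adj G x y -> x != r /\ y = pi x \/ y != r /\ x = pi y.
Proof.
move=> par /forestP acyc xy.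
pose h := [rel x y | (x != r) && (y == pi x) || (y != r) && (x == pi y)].
have [/orP[]/andP[? /eqP ?] | hxy] := boolP (h x y); [by left | by right |].
have hC : connect_sym h.
  by apply: sym_connect_sym => u v; rewrite /= orbC.
have toroot u : connect h u r.
  have [n] := ubnP (d u); elim: n u => // n IHn u; rewrite ltnS => du.
  have [-> // | ur] := eqVneq u r; have [_ dpi] := par u ur.
  apply: connect_trans (connect1 _) (IHn (pi u) _); first by rewrite /= ur eqxx.
  exact: leq_trans dpi du.
have : connect h x y by apply: connect_trans (toroot x) _; rewrite hC.
case/connectP=> p0 /shortenP[p hp up _ {p0} yp].
have subh : subrel h (adj G).
  by move=> u v /orP[]/andP[/par[+ _] /eqP->] //; rewrite adjC.
have cyc : ucycleb (adj G) (x :: p).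
  by rewrite /ucycleb up /= rcons_path -yp (sub_path subh hp) (adjC G y) xy.
have : ~~ (2 < size (x :: p)) by apply: contraL cyc; apply: acyc.
case: p hp yp {up cyc} => [|z [|//]] /=.
  by move=> _ yx; move: (adj_neq xy); rewrite yx eqxx.
by move=> + yz _; rewrite -yz andbT => hz; case/negP: hxy.
Qed.

Section ParentEdges.

Variables (r : V) (d : V -> nat) (pi : V -> V).
Hypothesis par : forall x, x != r -> adj G x (pi x) /\ d (pi x) < d x.

Let parent_edges := [set [set x; pi x] | x in [set~ r]].

Lemma parent_edges_sub : parent_edges \subset edges G.
Proof.
by apply/subsetP=> _ /imsetP[x xr ->]; apply: (par _).1; move: xr; rewrite !inE.
Qed.

(** Two vertices with the same parent edge would be parents of each other, which the decrease of [d]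
    forbids. So there is one edge per vertex other than the root. *)
Lemma card_parent_edges : #|V| = #|parent_edges|.+1.
Proof.
rewrite card_in_imset ?cardsC1 ?prednK //; first by apply/card_gt0P; exists r.
move=> x y; rewrite !inE => xr yr xyE; have [_ dx] := par xr; have [_ dy] := par yr.
have : x \in [set y; pi y] by rewrite -xyE set21.
have : y \in [set x; pi x] by rewrite xyE set21.
rewrite !inE => /orP[/eqP // | /eqP yE] /orP[/eqP // | /eqP xE].
by move: dx dy; rewrite -yE -xE; lia.
Qed.

End ParentEdges.

Lemma leq_card_connected : #|V| <= #|edges G|.+1.
Proof.
have [r [d [pi par]]] := exists_parent.
by rewrite (card_parent_edges par) ltnS subset_leq_card ?(parent_edges_sub par).
Qed.

(** Both sides say that the parent edges exhaust the edge set. *)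
Lemma forest_card : forest G = (#|V| == #|edges G|.+1).
Proof.
have [r [d [pi par]]] := exists_parent.
have sub := parent_edges_sub par.
rewrite (card_parent_edges par) eqSS (subset_leqif_cards sub).2 eqEsubset sub /=.
apply/idP/idP => [forG | Esub].
  apply: sub_edges => x y xy.
  apply/imsetP; have [[xr ->] | [yr ->]] := tree_edge_parent par forG xy.
    by exists x; rewrite ?inE.
  by exists y; rewrite ?inE // setUC.
apply: (@forest_parent d pi) => x y xy.
have /imsetP[z] := subsetP Esub _ xy; rewrite !inE => zr xyE.
have : x \in [set z; pi z] by rewrite -xyE set21.
have : y \in [set z; pi z] by rewrite -xyE set22.
have [_ dz] := par z zr; have := adj_neq xy; rewrite !inE => /eqP xy_neq.
by move=> /orP[]/eqP yE /orP[]/eqP xE; subst; [ | right | left | ].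
Qed.

End Trees.

Lemma tree_card (V : finType) (G : graph V) :
  tree G = connected G && (#|V| == #|edges G|.+1).
Proof. by apply: andb_id2l => /forest_card. Qed.

(** * Asymmetric trees on seven or more vertices *)

Section RelGraph.

Variables (V : finType) (r : rel V).

Definition rel_edges : {set {set V}} :=
  [set e : {set V} | (#|e| == 2) && [exists x, exists y, (e == [set x; y]) && r x y]].

Lemma rel_edges_card2 : [forall e in rel_edges, #|e| == 2].
Proof. by apply/forall_inP=> e; rewrite inE => /andP[]. Qed.

Definition rel_graph : graph V := Graph rel_edges_card2.

Lemma adj_rel_graph : symmetric r -> irreflexive r -> adj rel_graph =2 r.
Proof.
move=> rC rI x y; rewrite /adj inE cards2.
have [<- | xy] /= := eqVneq x y; first by symmetry; apply: rI.
apply/existsP/idP => [[u /existsP[v /andP[/eqP xyE uv]]] | rxy]; last first.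
  by exists x; apply/existsP; exists y; rewrite eqxx.
have : x \in [set u; v] by rewrite -xyE set21.
have : y \in [set u; v] by rewrite -xyE set22.
rewrite !inE => /orP[]/eqP yE /orP[]/eqP xE; subst; rewrite ?eqxx // in xy *.
by rewrite rC.
Qed.

End RelGraph.

(* A path on the vertices [0, ..., m - 2] with one more leaf [m - 1] attached to
   the vertex [2]; for [m >= 7] its three legs have lengths [1 < 2 < m - 4]. *)
Definition spider_rel (m : nat) : rel nat := fun i j =>
  [|| (i.+1 == j) && (j < m.-1), (j.+1 == i) && (i < m.-1),
      (i == 2) && (j == m.-1) | (j == 2) && (i == m.-1)].

Definition spider (m : nat) : graph 'I_m :=
  rel_graph (fun i j : 'I_m => spider_rel m i j).

Section Spider.

Variable m : nat.
Hypothesis m7 : 7 <= m.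

Lemma adj_spider (x y : 'I_m) : adj (spider m) x y = spider_rel m x y.
Proof.
apply: adj_rel_graph => {x y} [x y | x].
  by rewrite /spider_rel; lia.
by rewrite /spider_rel; lia.
Qed.

Lemma spider_tree : tree (spider m).
Proof.
have [m' mE] : exists m', m = m'.+1 by exists m.-1; lia.
pose par i := if i == m.-1 then 2 else i.-1.
have par_lt i : i < m -> par i < m by rewrite /par; case: eqP; lia.
pose pi (i : 'I_m) : 'I_m := Ordinal (par_lt i (ltn_ord i)).
have r0 : 0 < m by lia.
apply/andP; split.
  apply: (@connected_parent _ _ (Ordinal r0) (fun i => i) pi) => i.
  rewrite -val_eqE /= adj_spider /= /spider_rel /par => i0.
  by have := ltn_ord i; split; case: (nat_of_ord i =P m.-1) i0; lia.
apply: (@forest_parent _ _ (fun i : 'I_m => i : nat) pi) => i j.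
rewrite adj_spider /spider_rel => ij; have im := ltn_ord i; have jm := ltn_ord j.
suff: j < i /\ j = par i :> nat \/ i < j /\ i = par j :> nat.
  by move=> [] [ltij ijE]; [left | right]; split=> //; apply: val_inj.
by move: ij; rewrite /par; case: (nat_of_ord i =P m.-1); case: (nat_of_ord j =P m.-1); lia.
Qed.

End Spider.

Lemma spider_asymmetric m : 7 <= m -> asymmetric (spider m).
Proof.
case: m => // m'; set m := m'.+1 => m7.
apply/forallP=> p; apply/implyP=> autp.
pose g i : nat := p (inord i).
have gval i : i < m -> p (inord i) = inord (g i) by move=> _; rewrite /g inord_val.
have g_lt i : g i < m by apply: ltn_ord.
have g_inj i j : i < m -> j < m -> g i = g j -> i = j.
  by move=> im jm /val_inj/perm_inj/(congr1 val); rewrite /= !inordK.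
have g_rel i j : i < m -> j < m -> spider_rel m (g i) (g j) = spider_rel m i j.
  move=> im jm; have := automorphism_adj (inord i) (inord j) autp.
  by rewrite !adj_spider // !inordK.
have g_surj j : j < m -> exists2 i, i < m & g i = j.
  move=> jm; exists ((p^-1)%g (inord j)) => //.
  by rewrite /g inord_val permKV inordK.
suff gK : forall i, i < m -> g i = i.
  apply/eqP/permP=> i; rewrite perm1; apply: val_inj.
  by rewrite /= -[in RHS](gK i (ltn_ord i)) /g inord_val.
have gne i j : i < m -> j < m -> i <> j -> g i <> g j.
  by move=> im jm ij /g_inj; auto.
have adjg i j : i < m -> j < m -> spider_rel m i j -> spider_rel m (g i) (g j).
  by move=> im jm; rewrite g_rel.
(* [2] is the only vertex with three neighbours. *)
have three x a b c : spider_rel m x a -> spider_rel m x b -> spider_rel m x c ->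
    a <> b -> a <> c -> b <> c -> x = 2.
  rewrite /spider_rel.
  by do 3!case/or4P=> /andP[/eqP ? ?]; lia.
have g2 : g 2 = 2.
  by apply: (three _ (g 1) (g 3) (g m.-1)); (apply: adjg || apply: gne);
    rewrite ?/spider_rel; lia.
have mm : m.-1 < m by lia.
have [m0 m1 m2 m3 m4] : [/\ 0 < m, 1 < m, 2 < m, 3 < m & 4 < m] by split; lia.
have m5 : 5 < m by lia.
have rel1 a : spider_rel m 1 a -> a = 0 \/ a = 2.
  by rewrite /spider_rel; case/or4P=> /andP[/eqP ? ?]; lia.
have rel2 a : spider_rel m a 2 -> [\/ a = 1, a = 3 | a = m.-1].
  rewrite /spider_rel; case/or4P=> /andP[/eqP ? ?];
    by [constructor 1; lia | constructor 2; lia | constructor 3; lia | lia].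
have rel_last a : spider_rel m m.-1 a -> a = 2.
  by rewrite /spider_rel; case/or4P=> /andP[/eqP ? ?]; lia.
have glast : g m.-1 = m.-1.
  have not_last a b : b < m -> b <> 2 -> spider_rel m a b -> g m.-1 <> a.
    move=> bm b2 ab ga; have [i im gi] := g_surj b bm.
    by move: ab; rewrite -ga -gi g_rel // => /rel_last i2; rewrite -gi i2 g2 in b2.
  have : spider_rel m (g m.-1) 2.
    by rewrite -[X in spider_rel _ _ X]g2 adjg // /spider_rel !eqxx !orbT.
  case/rel2=> // ga; first by case: (@not_last 1 0 m0); rewrite // /spider_rel; lia.
  by case: (@not_last 3 4 m4); rewrite // /spider_rel; lia.
have g13 a : a = 1 \/ a = 3 -> g a = 1 \/ g a = 3.
  move=> aE; have am : a < m by lia.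
  have : spider_rel m (g a) 2.
    by rewrite -[X in spider_rel _ _ X]g2 adjg // /spider_rel; lia.
  case/rel2; auto; rewrite -[X in _ = X -> _]glast => ga.
  by case: (@gne a m.-1); lia.
have [g1 g3] : g 1 = 1 /\ g 3 = 3.
  have ne13 : g 1 <> g 3 by apply: gne.
  have [g1 | g1] := g13 1 (or_introl erefl);
    have [g3 | g3] := g13 3 (or_intror erefl) => //; try lia.
  (* Only the case where [g] exchanges [1] and [3] is left. Then [4] goes to [0], whose only
     neighbour [1] is already the image of [3], so [5] has no image. That [5] is adjacent to [4]
     uses [7 <= m]. *)
  have g4 : g 4 = 0.
    have : spider_rel m (g 3) (g 4) by apply: adjg => //; rewrite /spider_rel; lia.
    by rewrite g3 => /rel1[] // g4; case: (@gne 4 2) => //; rewrite g2.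
  have : spider_rel m (g 4) (g 5) by apply: adjg => //; rewrite /spider_rel; lia.
  have : g 5 <> 1 by have := @gne 5 3 m5 m3; rewrite g3; apply.
  by rewrite g4 /spider_rel; case: (g 5) => [|[|k]] //=; lia.
have g0 : g 0 = 0.
  have : spider_rel m (g 1) (g 0) by apply: adjg => //; rewrite /spider_rel; lia.
  by rewrite g1 => /rel1[] // g0; case: (@gne 0 2) => //; rewrite g2.
move=> i; have [k] := ubnP i; elim: k i => // k IHk i; rewrite ltnS => ik im.
have [i3 | i4] := leqP i 3.
  by move: i3; case: i {im ik} => [|[|[|[|]]]].
have [-> // | /eqP il] := eqVneq i m.-1.
have gi1 : g i.-1 = i.-1 by apply: IHk; lia.
have gi2 : g i.-2 = i.-2 by apply: IHk; lia.
(* Inside the long leg [i.-1] has only the neighbours [i.-2] and [i], and the first is already the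
   image of [i.-2]. *)
have := @gne i i.-2 im; rewrite gi2 => gi_ne.
have : spider_rel m (g i.-1) (g i).
  by apply: adjg; rewrite // /spider_rel; lia.
by rewrite gi1 /spider_rel; case/or4P=> /andP[/eqP ? ?]; lia.
Qed.

(** * Sparse graphs on at most six vertices *)

Section Sublists.

Variable T : eqType.

Fixpoint sublists (k : nat) (s : seq T) : seq (seq T) :=
  if s is x :: s' then
    sublists k s' ++ (if k is k'.+1 then map (cons x) (sublists k' s') else [::])
  else [:: [::]].

Lemma mem_sublists k (l s : seq T) :
  subseq l s -> size l <= k -> l \in sublists k s.
Proof.
elim: s k l => [|x s IHs] k [|y l] //=; rewrite mem_cat.
  by move=> _ _; rewrite IHs ?sub0seq.
case: eqP => [-> ls | _ ls ltlk]; last by rewrite IHs.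
by case: k => // k lk; rewrite map_f ?orbT ?IHs.
Qed.

End Sublists.

Definition swap (e : nat * nat) (x : nat) : nat :=
  if x == e.1 then e.2 else if x == e.2 then e.1 else x.

Definition swaps (s : seq (nat * nat)) (x : nat) : nat := foldr swap x s.

Definition ordered_pairs (m : nat) : seq (nat * nat) :=
  [seq e <- [seq (i, j) | i <- iota 0 m, j <- iota 0 m] | e.1 < e.2].

Definition edge_mem (l : seq (nat * nat)) (i j : nat) : bool :=
  has (fun e => (e.1 == i) && (e.2 == j) || (e.1 == j) && (e.2 == i)) l.

(* Products of at most three disjoint transpositions; shorter ones first, since
   most sparse graphs have a transposition as an automorphism. *)
Definition involutions (m : nat) : seq (seq (nat * nat)) :=
  [seq s <- flatten [seq [seq s <- sublists k (ordered_pairs m) | size s == k]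
                    | k <- iota 1 3]
    | [&& uniq (flatten [seq [:: e.1; e.2] | e <- s]),
          all (fun e => (e.1 < m) && (e.2 < m)) s
        & has (fun x => swaps s x != x) (iota 0 m)]].

(** Bounding the number of edges by [m - 1] covers all trees without testing connectedness or
    acyclicity, and keeps the search small: 4944 edge lists for [m = 6]. *)
Definition sparse_graphs_symmetric (m : nat) : bool :=
  let invs := involutions m in
  all (fun l => has (fun s => all (fun e => edge_mem l (swaps s e.1) (swaps s e.2)) l)
                    invs)
      (sublists m.-1 (ordered_pairs m)).

Lemma small_sparse_graphs_symmetric :
  all sparse_graphs_symmetric (iota 2 5).
Proof. by vm_compute. Qed.

Lemma swaps_perm m (s : seq (nat * nat)) :
  all (fun e => (e.1 < m) && (e.2 < m)) s ->
  exists p : {perm 'I_m}, forall x, p x = swaps s x :> nat.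
Proof.
elim: s => [_ | e s IHs /= /andP[/andP[e1 e2] /IHs[p pE]]].
  by exists 1%g => x; rewrite perm1.
exists (p * tperm (Ordinal e1) (Ordinal e2))%g => x; rewrite permM -pE /swap.
by case: tpermP => [-> | -> | /eqP + /eqP]; rewrite /= ?eqxx //;
  [case: eqP | rewrite -!val_eqE /= => /negbTE-> /negbTE->].
Qed.

Lemma sparse_asymmetric m (G : graph 'I_m) :
  1 < m -> #|edges G| < m -> asymmetric G -> 7 <= m.
Proof.
case: m G => [|m] // G m1; rewrite ltnS => edges_le /forallP asymG.
rewrite leqNgt; apply/negP=> m7.
have := allP small_sparse_graphs_symmetric m.+1.
rewrite mem_iota m1 m7 => /(_ isT)/allP.
pose l := [seq e <- ordered_pairs m.+1 | adj G (inord e.1) (inord e.2)].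
have memP e : (e \in ordered_pairs m.+1) = [&& e.1 < e.2, e.1 < m.+1 & e.2 < m.+1].
  rewrite mem_filter; congr (_ && _); apply/allpairsP/andP.
    by case=> [[i j] [+ + ->]]; rewrite !mem_iota.
  by case: e => i j [im jm]; exists (i, j); rewrite !mem_iota.
have mem_l (x y : 'I_m.+1) : edge_mem l x y = adj G x y.
  apply/hasP/idP => [[[i j]] | xy].
    rewrite mem_filter memP /= => /andP[ij _] /orP[]/andP[/eqP iE /eqP jE];
      by move: ij; rewrite iE jE !inord_val // adjC.
  have /negbTE := adj_neq xy; rewrite -val_eqE /= => xy_neq.
  case: (ltngtP x y) xy_neq => // [ltxy|ltyx] _.
    by exists (x : nat, y : nat); rewrite ?eqxx // mem_filter memP /= !inord_val xy ltxy !ltn_ord.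
  exists (y : nat, x : nat); rewrite ?eqxx ?orbT //.
  by rewrite mem_filter memP /= !inord_val adjC xy ltyx !ltn_ord.
have size_l : size l <= m.
  apply: leq_trans edges_le; rewrite cardE.
  rewrite -(size_map (fun e => [set inord e.1; inord e.2] : {set 'I_m.+1})).
  apply: uniq_leq_size => [|_ /mapP[e + ->]]; last first.
    by rewrite mem_filter mem_enum => /andP[].
  rewrite map_inj_in_uniq.
    by rewrite !filter_uniq // allpairs_uniq ?iota_uniq // => -[? ?] [? ?].
  move=> [i j] [i' j']; rewrite !(mem_filter _ _ (ordered_pairs _)) !memP /=.
  case/and4P=> [_ ij im jm] /and4P[_ ij' im' jm'] eqE.
  have : (inord i : 'I_m.+1) \in [set inord i'; inord j'] by rewrite -eqE set21.
  have : (inord j : 'I_m.+1) \in [set inord i'; inord j'] by rewrite -eqE set22.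
  rewrite !inE -!val_eqE /= !inordK //.
  by move=> /orP[]/eqP jE /orP[]/eqP iE; congr pair; lia.
move=> /(_ l (mem_sublists (filter_subseq _ _) size_l))/hasP[s].
rewrite mem_filter => /andP[/and3P[_ s_lt /hasP[x]]].
rewrite mem_iota => /= xm /negP moves _ /allP sE.
have [p pE] := swaps_perm s_lt.
apply: moves; have /implyP := asymG p.
have -> : automorphism G p.
  apply/automorphismP=> y z; rewrite -!mem_l !pE.
  case/hasP=> [[i j] /sE /= ij /orP[]/andP[/= /eqP<- /eqP<-]] //; move: ij.
  by rewrite /edge_mem; under eq_has => e do rewrite orbC.
by move=> /(_ isT)/eqP p1; rewrite -[x](inordK xm) -pE p1 perm1.
Qed.

(** * Lower bound from the tree components *)

(** Among [t + 1] distinct indices one is at least [t]. It pays for the term [sz t], and the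
    induction hypothesis applies to the others. *)
Lemma sum_initial_leq (sz : nat -> nat) (js : seq nat) :
  {homo sz : i j / i <= j} -> uniq js ->
  \sum_(j < size js) sz j <= \sum_(j <- js) sz j.
Proof.
move=> sz_mono; move szjs: (size js) => t.
elim: t js szjs => [|t IHt] js szjs ujs; first by rewrite big_ord0.
have [j jjs tj] : exists2 j, j \in js & t <= j.
  apply/hasP; apply: contraT => /hasPn js_lt.
  have := @uniq_leq_size _ js (iota 0 t) ujs; rewrite szjs size_iota ltnn.
  by apply=> j /js_lt; rewrite mem_iota /= -ltnNge.
have szrem : size (rem j js) = t by rewrite size_rem // szjs.
rewrite big_ord_recr (perm_big _ (perm_to_rem jjs)) big_cons /= addnC.
by rewrite leq_add ?sz_mono // IHt ?rem_uniq.
Qed.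

Section Components.

Variables (V : finType) (G : graph V).

Definition adj_closed (S : {set V}) := forall x y, adj G x y -> x \in S -> y \in S.

(** The induced subgraph is relabelled by an ordinal because [asym_tree_list] classifies only graphs
    on ordinals. *)
Definition piece (S : {set V}) : graph 'I_#|S| :=
  rel_graph (fun i j : 'I_#|S| => adj G (enum_val i) (enum_val j)).

Lemma adj_piece S i j : adj (piece S) i j = adj G (enum_val i) (enum_val j).
Proof.
apply: adj_rel_graph => {i j} [i j | i]; first by rewrite adjC.
by apply/negbTE/negP=> /adj_neq; rewrite eqxx.
Qed.

Lemma card_edges_piece S :
  #|edges (piece S)| <= #|[set e in edges G | e \subset S]|.
Proof.
rewrite -(card_imset _ (imset_inj (@enum_val_inj V (mem S)))).
apply/subset_leq_card/subsetP=> _ /imsetP[_ /edgeP[i [j [-> ij]]] ->].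
by rewrite imset_set2 inE subUset !sub1set !enum_valP -[_ \in _]adj_piece ij.
Qed.

Section Rigidity.

Hypothesis asymG : asymmetric G.

(* Exchanging [S] and [S'] along [f] and its inverse [g] is an automorphism. *)
Lemma asymmetric_exchange (S S' : {set V}) (f g : V -> V) :
  adj_closed S -> adj_closed S' -> S = S' \/ [disjoint S & S'] ->
  {in S, forall x, f x \in S'} -> {in S', forall x, g x \in S} ->
  {in S, cancel f g} -> {in S', cancel g f} ->
  {in S &, forall x y, adj G x y -> adj G (f x) (f y)} ->
  {in S' &, forall x y, adj G x y -> adj G (g x) (g y)} ->
  {in S, f =1 id}.
Proof.
move=> clS clS' SS' fS gS' fK gK fadj gadj.
pose q x := if x \in S then f x else if x \in S' then g x else x.
pose q' x := if x \in S' then g x else if x \in S then f x else x.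
have qK : cancel q q'.
  move=> x; rewrite /q /q'; have [xS | xS] := boolP (x \in S).
    by rewrite fS // fK.
  have [xS' | xS'] := boolP (x \in S'); last by rewrite (negbTE xS') (negbTE xS).
  rewrite (gS' x xS') gK //; case: ifP => // gxS'.
  case: SS' => [SE | dis]; first by rewrite SE xS' in xS.
  by rewrite (disjointFr dis (gS' x xS')) in gxS'.
have autq : automorphism G (perm (can_inj qK)).
  apply/automorphismP=> x y xy; rewrite !permE /q.
  have inS : (x \in S) = (y \in S).
    by apply/idP/idP; apply: clS; rewrite // adjC.
  have inS' : (x \in S') = (y \in S').
    by apply/idP/idP; apply: clS'; rewrite // adjC.
  rewrite -inS -inS'; case: ifP => xS; first by apply: fadj; rewrite -?inS.
  by case: ifP => xS' //; apply: gadj; rewrite -?inS'.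
have /eqP q1 := implyP (forallP asymG _) autq.
by move=> x xS; rewrite -[RHS](perm1 x) -q1 permE /q xS.
Qed.

(** One statement serves two purposes: with [S = S'] it makes each component asymmetric, and with
    [S] and [S'] disjoint it shows that distinct components are not isomorphic. *)
Lemma piece_rigid (S S' : {set V}) (h : 'I_#|S| -> 'I_#|S'|) :
  adj_closed S -> adj_closed S' -> S = S' \/ [disjoint S & S'] ->
  bijective h -> (forall i j, adj (piece S') (h i) (h j) = adj (piece S) i j) ->
  forall i, enum_val (h i) = enum_val i.
Proof.
move=> clS clS' SS' [h' hK h'K] hadj i.
have iS := enum_valP i; have iS' := enum_valP (h i).
pose f x : V := enum_val (h (enum_rank_in iS x)).
pose g x : V := enum_val (h' (enum_rank_in iS' x)).
have -> : enum_val (h i) = f (enum_val i) by rewrite /f enum_valK_in.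
have h'adj j l : adj (piece S) (h' j) (h' l) = adj (piece S') j l.
  by rewrite -hadj !h'K.
apply: (@asymmetric_exchange S S' f g) => //.
- by move=> x _; apply: enum_valP.
- by move=> x _; apply: enum_valP.
- by move=> x xS; rewrite /g /f enum_valK_in hK enum_rankK_in.
- by move=> x xS; rewrite /g /f enum_valK_in h'K enum_rankK_in.
- by move=> x y xS yS; rewrite -[_ (f x) _]adj_piece hadj adj_piece !enum_rankK_in.
- by move=> x y xS yS; rewrite -[_ (g x) _]adj_piece h'adj adj_piece !enum_rankK_in.
Qed.

Lemma piece_asymmetric S : adj_closed S -> asymmetric (piece S).
Proof.
move=> clS; apply/forallP=> p; apply/implyP=> autp; apply/eqP/permP=> i.
rewrite perm1; apply: enum_val_inj; apply: piece_rigid => //; first by left.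
  by exists (p^-1)%g; [apply: permK | apply: permKV].
by move=> j l; apply: automorphism_adj.
Qed.

Lemma piece_isomorphic S S' :
  S != set0 -> adj_closed S -> adj_closed S' -> S = S' \/ [disjoint S & S'] ->
  isomorphic (piece S) (piece S') -> S = S'.
Proof.
move=> /set0Pn[x xS] clS clS' SS' /isomorphicP[h [hbij hadj]].
have hE := piece_rigid clS clS' SS' hbij hadj.
case: SS' => // /disjointFr/(_ xS) xS'.
have := enum_valP (h (enum_rank_in xS x)).
by rewrite hE enum_rankK_in // xS'.
Qed.

End Rigidity.

Definition components : {set {set V}} :=
  equivalence_partition (connect (adj G)) [set: V].

Lemma connect_equivalence : {in [set: V] & &, equivalence_rel (connect (adj G))}.
Proof.
move=> x y z _ _ _; split=> [|xy]; first exact: connect0.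
exact: same_connect (sym_connect_sym (@adjC _ G)) _ _ xy z.
Qed.

Lemma components_partition : partition components [set: V].
Proof. exact: equivalence_partitionP connect_equivalence. Qed.

Lemma component_closed S : S \in components -> adj_closed S.
Proof.
case/imsetP=> r _ -> x y xy; rewrite !inE => rx.
exact: connect_trans rx (connect1 xy).
Qed.

Lemma component_neq0 S : S \in components -> S != set0.
Proof. exact: partition_neq0 components_partition. Qed.

Lemma component_disjoint S S' :
  S \in components -> S' \in components -> S = S' \/ [disjoint S & S'].
Proof.
move=> SP S'P; have /and3P[_ /trivIsetP triv _] := components_partition.
by have [-> | neq] := eqVneq S S'; [left | right; apply: triv].
Qed.

Lemma component_connected S : S \in components -> connected (piece S).
Proof.
move=> SP; have clS := component_closed SP; case/imsetP: SP => r _ SE.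
have rS : r \in S by rewrite SE !inE connect0.
apply/andP; split; first by rewrite card_ord (cardD1 r) rS.
have conn_r x : x \in S -> connect (adj (piece S)) (enum_rank_in rS r) (enum_rank_in rS x).
  rewrite {1}SE !inE => /connectP[p]; elim/last_ind: p x => [|p y IHp] x /=.
    by move=> _ ->; apply: connect0.
  rewrite rcons_path last_rcons => /andP[rp py] ->.
  have lS : last r p \in S by rewrite SE !inE; apply/connectP; exists p.
  apply: connect_trans (IHp _ rp erefl) (connect1 _).
  by rewrite adj_piece !enum_rankK_in // (clS _ _ py).
apply/forallP=> i; apply/forallP=> j; rewrite -[i](enum_valK_in rS) -[j](enum_valK_in rS).
apply: connect_trans (conn_r _ (enum_valP _)).
by rewrite (sym_connect_sym (@adjC _ _)) conn_r ?enum_valP.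
Qed.

(** Double counting: an edge lies in at most one component, the block of either of its ends. *)
Lemma sum_component_edges :
  \sum_(S in components) #|edges (piece S)| <= #|edges G|.
Proof.
have /and3P[_ triv _] := components_partition.
apply: (@leq_trans (\sum_(S in components) \sum_(e in edges G) (e \subset S))).
  apply: leq_sum => S _; apply: leq_trans (card_edges_piece S) _.
  by rewrite -sum1dep_card big_mkcondr; apply: leq_sum => e _; case: (e \subset S).
rewrite exchange_big -sum1_card; apply: leq_sum => _ /edgeP[x [y [-> _]]].
rewrite -big_mkcondr sum1dep_card -(cards1 (pblock components x)).
apply/subset_leq_card/subsetP=> S; rewrite !inE subUset !sub1set.
by case/and3P=> SP xS _; rewrite (def_pblock triv SP xS).
Qed.

Definition tree_components : {set {set V}} :=
  [set S in components | tree (piece S)].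

(** In each component the vertices exceed the edges by at most one, and by one exactly when it is a
    tree. *)
Lemma card_leq_tree_components : #|V| <= #|edges G| + #|tree_components|.
Proof.
rewrite -cardsT (card_partition components_partition).
apply: leq_trans (leq_add sum_component_edges (leqnn _)).
rewrite -sum1dep_card big_mkcondr -big_split; apply: leq_sum => S SP /=.
have conn := component_connected SP.
have := leq_card_connected conn; rewrite tree_card conn /= card_ord.
by case: eqP; lia.
Qed.

End Components.

Section LowerBound.

Variables (sz : nat -> nat) (Omega : forall j, graph 'I_(sz j)).
Hypothesis Omega_list : asym_tree_list Omega.

Lemma size_mono : {homo sz : i j / i <= j}.
Proof.
by have [_ _ mono] := Omega_list => i j; rewrite leq_eqVlt => /predU1P[-> | /mono].
Qed.

Lemma size_gt1 j : 1 < sz j.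
Proof. by have [/(_ j)[]] := Omega_list. Qed.

(** Tree components are pairwise non-isomorphic, so at most one is a single vertex and the others
    match distinct members of [Omega]. The hypothesis leaves no room for more than [k.+1] of
    them. *)
Lemma asymmetric_edges (V : finType) (G : graph V) (k : nat) :
  asymmetric G -> #|V| < 1 + \sum_(j < k.+1) sz j -> #|V| <= #|edges G| + k.+1.
Proof.
move=> asymG ltVk.
suff: #|tree_components G| <= k.+1.
  by move=> le; apply: leq_trans (card_leq_tree_components G) _; rewrite leq_add2l.
have PT S : S \in tree_components G -> S \in components G by rewrite inE => /andP[].
have iso_eq S S' : S \in tree_components G -> S' \in tree_components G ->
    isomorphic (piece G S) (piece G S') -> S = S'.
  move=> /PT SP /PT S'P; apply: piece_isomorphic => //.
  - exact: component_neq0 SP.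
  - exact: component_closed SP.
  - exact: component_closed S'P.
  - exact: component_disjoint SP S'P.
pose big := [set S in tree_components G | 1 < #|S|].
pose small := [set S in tree_components G | #|S| == 1].
have card_split : #|tree_components G| = #|big| + #|small|.
  rewrite -(cardsID [set S : {set V} | 1 < #|S|]); congr (_ + _); apply: eq_card => S.
    by rewrite !inE.
  rewrite [RHS]inE [LHS]inE andbC; apply: andb_id2l => /PT/component_neq0.
  by rewrite -card_gt0 inE -leqNgt eqn_leq andbC => ->.
have small1 : #|small| <= 1.
  apply/card_le1_eqP=> S S'; rewrite ![_ \in small]inE.
  move=> /andP[SP /eqP S1] /andP[S'P /eqP S'1]; apply: (iso_eq _ _ S'P SP).
  by apply: isomorphic_card1; rewrite card_ord.
(* Stated for every [S], with index [0] outside [big], so that finite choice yields a total function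
   [J]. *)
have exJ S : exists j, S \in big -> isomorphic (piece G S) (Omega j).
  have [Sbig | _] := boolP (S \in big); last by exists 0.
  move: Sbig; rewrite inE => /andP[SP S1]; have := SP; rewrite inE => /andP[SC ST].
  have [_ all _] := Omega_list.
  have [j [isoj _]] := all _ _ S1 ST (piece_asymmetric asymG (component_closed SC)).
  by exists j.
have [J isoJ] := fin_all_exists exJ.
pose js := [seq J X | X in big].
have szjs : size js = #|big| by rewrite size_map -cardE.
have ujs : uniq js.
  rewrite map_inj_in_uniq ?enum_uniq // => S S'; rewrite !mem_enum => SB S'B JE.
  have [SP S'P] : S \in tree_components G /\ S' \in tree_components G.
    by move: SB S'B; rewrite !inE => /andP[-> _] /andP[-> _].
  apply: iso_eq => //; apply: isomorphic_trans (isoJ _ SB) _.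
  by rewrite JE; apply: isomorphic_sym (isoJ _ S'B).
have sum_js : \sum_(j <- js) sz j + #|small| <= #|V|.
  rewrite big_map big_enum /= -[#|small|]sum1_card -[#|V|]cardsT.
  rewrite (card_partition (components_partition G)).
  rewrite big_mkcond [X in _ + X]big_mkcond [leqRHS]big_mkcond -big_split.
  apply: leq_sum => S _ /=; have [SP | SP] := boolP (S \in components G); last first.
    by rewrite !inE (negbTE SP).
  case: ifP => [SB | _]; last by rewrite add0n !inE; case: ifP => // /andP[_ /eqP->].
  move: (isomorphic_card (isoJ _ SB)); rewrite !card_ord => <-.
  move: SB; rewrite !inE => /andP[_ S1].
  by rewrite (gtn_eqF S1) andbF addn0.
have := leq_trans (leq_add (sum_initial_leq size_mono ujs) (leqnn _)) sum_js.
rewrite szjs => le_sum.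
have sum_mono a b : a <= b -> \sum_(j < a) sz j <= \sum_(j < b) sz j.
  by move=> leab; rewrite -!(big_mkord xpredT sz) (big_cat_nat (leq0n a) leab) leq_addr.
rewrite card_split leqNgt; apply/negP=> ltk.
(* Without an isolated vertex there are at least [k + 2] trees from [Omega], and the extra one has
   more than one vertex. With an isolated vertex, that vertex supplies the [1] and [k + 1] trees
   remain. *)
have [small0 | small_gt] := posnP #|small|.
  rewrite small0 !addn0 in le_sum ltk.
  have := leq_trans (sum_mono _ _ ltk) le_sum.
  rewrite big_ord_recr /= leqNgt => /negP; apply.
  by apply: leq_trans ltVk _; rewrite addnC leq_add2l ltnW ?size_gt1.
have ltk' : k.+1 <= #|big| by move: ltk small1; lia.
have := leq_trans (leq_add (sum_mono _ _ ltk') small_gt) le_sum.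
by rewrite addnC leqNgt ltVk.
Qed.

End LowerBound.

(** * Forests of distinct asymmetric trees *)

Section ConnectedTheory.

Variables (W : finType) (T : graph W).
Hypothesis Tconn : connected T.

Lemma connected_ind (P : pred W) w0 :
  (forall w w', adj T w w' -> P w -> P w') -> P w0 -> forall w, P w.
Proof.
move=> Padj Pw0 w; have /andP[_ /forallP/(_ w0)/forallP/(_ w)] := Tconn.
case/connectP=> p; elim: p w0 Pw0 => [|x p IHp] w0 Pw0 /=; first by move=> _ ->.
by case/andP=> /Padj/(_ Pw0)/IHp; apply.
Qed.

Lemma connected_neighbour : 1 < #|W| -> forall w, exists w', adj T w w'.
Proof.
move=> W1 w; have /existsP[w' ww'] : [exists w', w' != w].
  apply: contraTT W1 => /existsPn all_w; rewrite -leqNgt -cardsT -(cards1 w).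
  by apply/subset_leq_card/subsetP=> x _; rewrite inE; apply/negPn/all_w.
apply/existsP; apply: contraNT ww' => /existsPn no_w; apply/eqP.
have /andP[_ /forallP/(_ w)/forallP/(_ w')/connectP[[|x p] /=]] := Tconn => //.
by rewrite (negbTE (no_w x)).
Qed.

End ConnectedTheory.

Lemma copy_isomorphism (W W' V : finType) (T : graph W) (T' : graph W')
    (G : graph V) (p : {perm V}) (f : W -> V) (f' : W' -> V) :
  injective f -> (forall x y, adj G (f x) (f y) = adj T x y) ->
  injective f' -> (forall x y, adj G (f' x) (f' y) = adj T' x y) ->
  automorphism G p ->
  (forall x, p (f x) \in f' @: [set: W']) ->
  (forall y, (p^-1)%g (f' y) \in f @: [set: W]) ->
  exists h : W -> W', [/\ bijective h,
    forall x y, adj T' (h x) (h y) = adj T x y & forall x, f' (h x) = p (f x)].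
Proof.
move=> finj fadj f'inj f'adj autp pf pf'.
have ex_h x : exists y, f' y = p (f x) by have /imsetP[y _ ->] := pf x; exists y.
have ex_g y : exists x, f x = (p^-1)%g (f' y).
  by have /imsetP[x _ ->] := pf' y; exists x.
have [h hE] := fin_all_exists ex_h; have [g gE] := fin_all_exists ex_g.
exists h; split=> // [|x y].
  exists g => [x | y]; first by apply: finj; rewrite gE hE permK.
  by apply: f'inj; rewrite hE gE permKV.
by rewrite -f'adj !hE (automorphism_adj _ _ autp) fadj.
Qed.

Lemma mem_red_edges (V : finType) (c : seq ({set V} * {set {set V}})) e :
  (e \in red_edges c) = has (fun a : {set V} * {set {set V}} => e \in a.2) c.
Proof.
rewrite /red_edges; elim: c => [|a c IHc]; first by rewrite big_nil inE.
by rewrite big_cons inE IHc.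
Qed.

Section Packings.

Variables (sz : nat -> nat) (Omega : forall j, graph 'I_(sz j)).
Hypothesis Omega_list : asym_tree_list Omega.
Variable V : finType.

Local Notation entry := (nat * ({set V} * {set {set V}}))%type.

(* The trees [Omega j], for the pairwise distinct indices [j] in [q], are placed
   on disjoint sets of vertices; [A] is what remains besides [v]. *)
Inductive packing (v : V) : seq entry -> {set V} -> Prop :=
| PackNone : packing v [::] [set~ v]
| PackCons q A j (S : {set V}) F :
    packing v q A -> S \subset A -> is_copy (Omega j) S F ->
    j \notin [seq a.1 | a <- q] -> packing v ((j, (S, F)) :: q) (A :\: S).

Section PackingTheory.

Variables (v : V) (q : seq entry) (A : {set V}).
Hypothesis qA : packing v q A.

Lemma packing_copy a : a \in q -> is_copy (Omega a.1) a.2.1 a.2.2.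
Proof.
by elim: qA => // q1 B j S F _ IHq _ cSF _; rewrite inE => /predU1P[-> | /IHq].
Qed.

Lemma packing_left x :
  (x \in A) = (x != v) && ~~ has (fun a : entry => x \in a.2.1) q.
Proof.
elim: qA => [|q1 B j S F _ IHq _ _ _]; first by rewrite !inE andbT.
by rewrite inE IHq /= negb_or andbC -andbA; congr (_ && _); rewrite andbC.
Qed.

Lemma packing_notin a : a \in q -> v \notin a.2.1.
Proof.
elim: qA => // q1 B j S F qB IHq SB _ _; rewrite inE => /predU1P[-> | /IHq //].
apply/negP=> /(subsetP SB); suff: v \notin B by move/negP.
by elim: qB => [|*]; rewrite !inE ?eqxx ?negb_and; [|apply/orP; right].
Qed.

Lemma packing_index : {in q &, forall a b, a.1 = b.1 -> a = b}.
Proof.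
elim: qA => // q1 B j S F _ IHq _ _ jq a b.
rewrite !inE => /predU1P[-> | aq] /predU1P[-> | bq] //=.
- by move=> jb; rewrite jb map_f in jq.
- by move=> ja; rewrite -ja map_f in jq.
- exact: IHq.
Qed.

End PackingTheory.

Lemma packing_disjoint v q A : packing v q A ->
  {in q &, forall (a b : entry) x, x \in a.2.1 -> x \in b.2.1 -> a = b}.
Proof.
elim=> // {A}{}q B j S F qB IHq SB _ _ a b.
have notS x c : c \in q -> x \in c.2.1 -> x \in S -> False.
  move=> cq xc /(subsetP SB); rewrite (packing_left qB) => /andP[_ /hasPn/(_ _ cq)].
  by rewrite xc.
rewrite !inE => /predU1P[-> | aq] /predU1P[-> | bq] x //=.
- by move=> xS xb; case: (notS x b).
- by move=> xa xS; case: (notS x a).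
- exact: IHq.
Qed.

(** Each placed tree has one edge fewer than vertices; the final [1] is [v]. *)
Lemma packing_card v q A : packing v q A ->
  #|V| = #|red_edges [seq a.2 | a <- q]| + size q + #|A| + 1.
Proof.
elim=> [|{A}{}q B j S F qB IHq SB cSF _].
  by rewrite /red_edges big_nil cards0 cardsC1 addn1 prednK //; apply/card_gt0P; exists v.
rewrite IHq /red_edges big_cons -/(red_edges _) /=.
(* A common edge would have an end both in [S] and in an earlier block. *)
have dis : [disjoint F & red_edges [seq a.2 | a <- q]].
  apply/pred0P=> e /=; apply/negbTE/andP=> -[eF].
  rewrite mem_red_edges has_map => /hasP[a aq ea].
  have /card_gt0P[x xe] : 0 < #|e| by rewrite (copy_edge_card2 cSF eF).
  have := subsetP SB _ (subsetP (copy_edge_sub cSF eF) _ xe).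
  rewrite (packing_left qB) => /andP[_ /hasPn/(_ _ aq)].
  by rewrite (subsetP (copy_edge_sub (packing_copy qB aq) ea)).
rewrite cardsU (disjoint_setI0 dis) cards0 subn0 (card_copy_edges cSF).
have [/(_ j)[sz1 treeT _] _ _] := Omega_list.
have := subset_leq_card SB; rewrite (cardsDS SB) (card_copy cSF).
move: treeT; rewrite tree_card card_ord => /andP[_ /eqP].
by move: (sz j) #|B| #|red_edges _| #|edges _| (size q); lia.
Qed.

Section Forest.

Variables (v : V) (q : seq entry) (G : graph V).
Hypothesis packed : packing v q set0.
Hypothesis edgesG : edges G = red_edges [seq a.2 | a <- q].

Lemma packing_block x : x != v -> exists2 a, a \in q & x \in a.2.1.
Proof.
move=> xv; apply/hasP; have := packing_left packed x.
by rewrite inE xv /= => /esym/negbFE.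
Qed.

Lemma packing_edge a x y :
  a \in q -> adj G x y -> x \in a.2.1 -> [set x; y] \in a.2.2.
Proof.
rewrite /adj edgesG mem_red_edges has_map => aq /hasP[b bq /= xyb] xa.
have xb : x \in b.2.1.
  by apply: (subsetP (copy_edge_sub (packing_copy packed bq) xyb)); rewrite set21.
by rewrite (packing_disjoint packed aq bq xa xb).
Qed.

Lemma packing_closed a : a \in q -> adj_closed G a.2.1.
Proof.
move=> aq x y xy xa; have := packing_edge aq xy xa.
by move/(copy_edge_sub (packing_copy packed aq))/subsetP; apply; rewrite set22.
Qed.

Lemma packing_embedding a : a \in q ->
  exists f : 'I_(sz a.1) -> V,
    [/\ injective f, a.2.1 = f @: [set: _]
      & forall x y, adj G (f x) (f y) = adj (Omega a.1) x y].
Proof.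
move=> aq; have /is_copyP[f [finj SE FE]] := packing_copy packed aq.
exists f; split=> // x y; rewrite -(mem_copy_edges _ x y finj) -FE.
apply/idP/idP => [xy | xyF].
  by apply: (packing_edge aq xy); rewrite SE imset_f.
by rewrite /adj edgesG mem_red_edges has_map; apply/hasP; exists a.
Qed.

Lemma packing_neighbour x : x != v -> exists y, adj G x y.
Proof.
case/packing_block=> a aq xa; have [f [_ SE fadj]] := packing_embedding aq.
have [/(_ a.1)[sz1 /andP[Tconn _] _] _ _] := Omega_list.
move: xa; rewrite SE => /imsetP[w _ ->].
have [|w' ww'] := connected_neighbour Tconn _ w; first by rewrite card_ord.
by exists (f w'); rewrite fadj.
Qed.

Lemma packing_isolated x y : adj G x y -> x != v.
Proof.
rewrite /adj edgesG mem_red_edges has_map => /hasP[a aq /= xyF].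
apply: contraNneq (packing_notin packed aq) => <-.
by apply: (subsetP (copy_edge_sub (packing_copy packed aq) xyF)); rewrite set21.
Qed.

Lemma packing_cover : #|cover (edges G)| = #|V| - 1.
Proof.
rewrite subn1 -(cardsC1 v); congr #|pred_of_set _|; apply/setP=> x; rewrite !inE.
apply/bigcupP/idP => [[e /edgeP[y [z [-> yz]]]] | /packing_neighbour[y xy]].
  by rewrite !inE => /orP[]/eqP->; [|rewrite adjC in yz]; apply: packing_isolated yz.
by exists [set x; y]; rewrite ?set21.
Qed.

(** A cycle avoids the isolated vertex [v] and never leaves a block, so it pulls back to a cycle in
    one of the trees. *)
Lemma packing_forest : forest G.
Proof.
apply/forestP=> s s3; apply/negP=> /andP[scyc us].
case: s => // x s in s3 scyc us; move: (scyc); rewrite /= rcons_path => /andP[xs sx].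
have /packing_block[a aq xa] : x != v by rewrite adjC in sx; apply: packing_isolated sx.
have [f [finj SE fadj]] := packing_embedding aq.
have [t tE] : exists t, x :: s = map f t.
  elim: s x xs xa {s3 scyc us sx} => [|y s IHs] x.
    by move=> _; rewrite SE => /imsetP[w _ ->]; exists [:: w].
  move=> /= /andP[xy ys] /[dup] xa; rewrite {1}SE => /imsetP[w _ ->].
  by have [t ->] := IHs _ ys (packing_closed aq xy xa); exists (w :: t).
have [/(_ a.1)[_ /andP[_ /forestP acyc] _] _ _] := Omega_list; have := acyc t.
rewrite -(size_map f) -tE => /(_ s3)/negP; apply; apply/andP; split.
  rewrite -(eq_cycle (e := relpre f (adj G))); first by rewrite -cycle_map -tE.
  by move=> u w; apply: fadj.
by rewrite -(map_inj_uniq finj) -tE.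
Qed.

Lemma Omega_inj i j : isomorphic (Omega i) (Omega j) -> i = j.
Proof.
have [/(_ i)[sz1 treeT asymT] allT _] := Omega_list => isoij.
have [k [_ uniqk]] := allT _ _ sz1 treeT asymT.
by rewrite -(uniqk _ isoij) (uniqk _ (isomorphic_refl _)).
Qed.

Lemma packing_asymmetric : asymmetric G.
Proof.
apply/forallP=> p; apply/implyP=> autp; apply/eqP/permP=> x0; rewrite perm1.
(* A block is connected, so its image stays inside the block that it meets. This is applied to [p]
   and to its inverse. *)
have move_block (r : {perm V}) a b x : automorphism G r -> a \in q -> b \in q ->
    x \in a.2.1 -> r x \in b.2.1 -> {in a.2.1, forall y, r y \in b.2.1}.
  move=> autr aq bq xa rxb y ya; have [f [_ SE fadj]] := packing_embedding aq.
  have [/(_ a.1)[_ /andP[Tconn _] _] _ _] := Omega_list.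
  move: xa rxb ya; rewrite SE => /imsetP[w0 _ ->] rw0 /imsetP[w _ ->].
  apply: (connected_ind Tconn (P := fun w => r (f w) \in b.2.1)) rw0 w => w w' ww'.
  by apply: (packing_closed bq); rewrite (automorphism_adj _ _ autr) fadj.
have fixp x : x != v -> p x = x.
  move=> xv; have [a aq xa] := packing_block xv; have [y xy] := packing_neighbour xv.
  have pxv : p x != v.
    by apply: (packing_isolated (y := p y)); rewrite (automorphism_adj _ _ autp).
  have [b bq pxb] := packing_block pxv.
  have [f [finj SE fadj]] := packing_embedding aq.
  have [f' [f'inj SE' f'adj]] := packing_embedding bq.
  have pab := move_block _ _ _ _ autp aq bq xa pxb.
  have pba : {in b.2.1, forall y, (p^-1)%g y \in a.2.1}.
    by apply: (move_block _ b a (p x)) => //; [apply: automorphismV | rewrite permK].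
  (* The blocks [a] and [b] carry isomorphic trees, and distinct entries have non-isomorphic
     ones. *)
  have ab : a = b.
    have [||h [hbij hadj _]] := copy_isomorphism finj fadj f'inj f'adj autp.
    - by move=> w; rewrite -SE' pab // SE imset_f.
    - by move=> w; rewrite -SE pba // SE' imset_f.
    apply: (packing_index packed) => //; apply: Omega_inj.
    by apply/isomorphicP; exists h.
  rewrite -{b bq pxb f' f'inj SE' f'adj}ab in pab pba.
  (* Now [p] restricts to an automorphism of the asymmetric tree [Omega a.1], hence fixes the block
     pointwise. *)
  have [||h [hbij hadj hE]] := copy_isomorphism finj fadj finj fadj autp.
  - by move=> w; rewrite -SE pab // SE imset_f.
  - by move=> w; rewrite -SE pba // SE imset_f.
  have [/(_ a.1)[_ _ /forallP asymT] _ _] := Omega_list.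
  have /implyP := asymT (perm (bij_inj hbij)).
  have -> : automorphism (Omega a.1) (perm (bij_inj hbij)).
    by apply/automorphismP=> u w; rewrite !permE hadj.
  move=> /(_ isT)/eqP h1; move: xa; rewrite SE => /imsetP[w _ ->].
  by rewrite -hE; congr f; rewrite -(permE (bij_inj hbij)) h1 perm1.
(* If [p v] differed from [v], it would be fixed by [p], and injectivity would give [p v = v]. *)
have [-> | ] := eqVneq x0 v; last exact: fixp.
by apply/eqP; apply: contraT => pv; have /fixp/perm_inj := pv; move/eqP: pv.
Qed.

End Forest.

End Packings.

(** * The procedure and the edge cost *)

Section Procedure.

Variables (sz : nat -> nat) (Omega : forall j, graph 'I_(sz j)).
Hypothesis Omega_list : asym_tree_list Omega.

Lemma size_ge7 j : 7 <= sz j.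
Proof.
have [/(_ j)[sz1 treeT asymT] _ _] := Omega_list.
apply: (sparse_asymmetric sz1) asymT.
move: treeT; rewrite tree_card card_ord => /andP[_ /eqP cardE].
by rewrite [ltnRHS]cardE.
Qed.

Lemma size_onto m : 7 <= m -> exists j, sz j = m.
Proof.
move=> m7; have [_ allT _] := Omega_list.
have m1 : 1 < m by apply: leq_trans m7.
have [j [isoj _]] := allT m _ m1 (spider_tree m7) (spider_asymmetric m7).
by exists j; move: (isomorphic_card isoj); rewrite !card_ord.
Qed.

Variable V : finType.

Lemma reached_packing c (A : {set V}) : reached Omega c A ->
  exists v q, [/\ packing Omega v q A, [seq a.2 | a <- q] = c,
    forall j, (j \in [seq a.1 | a <- q]) = (j < size c)
    & #|V| = 1 + #|A| + \sum_(j < size c) sz j].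
Proof.
elim=> [v | {A}{}c A S F _ [v [q [qA qc qj cardV]]] SA cSF].
  exists v, [::]; split=> //; first exact: PackNone.
  by rewrite big_ord0 addn0 cardsC1 add1n prednK //; apply/card_gt0P; exists v.
exists v, ((size c, (S, F)) :: q); split.
- by apply: PackCons => //; rewrite qj ltnn.
- by rewrite /= qc.
- by move=> j; rewrite inE qj /= ltnS [RHS]leq_eqVlt.
rewrite cardV big_ord_recr /= (cardsDS SA) (card_copy cSF) card_ord.
have := subset_leq_card SA; rewrite (card_copy cSF) card_ord.
by move: (sz (size c)) #|A| (\sum_(_ < _) _); lia.
Qed.

Lemma reached_cons c (A S : {set V}) F : reached Omega ((S, F) :: c) A ->
  exists B : {set V}, [/\ reached Omega c B, S \subset B,
    is_copy (Omega (size c)) S F, A = B :\: S & A :|: S = B].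
Proof.
move=> cA; inversion cA as [|c' B S' F' cB SB cSF]; subst; exists B; split=> //.
by rewrite setUC -{1}(setIidPr SB) setID.
Qed.

(* The replacing tree [Omega j] is larger than the one it replaces, so it is not
   among the trees placed before. *)
Lemma replacement_index i j (B S : {set V}) F :
  is_copy (Omega i) S F -> S \subset B -> B :\: S != set0 -> sz j = #|B| -> i < j.
Proof.
move=> cSF SB BS szj; rewrite ltnNge; apply/negP=> /(size_mono Omega_list).
rewrite szj leqNgt => /negP; apply; have := card_copy cSF; rewrite card_ord => <-.
apply: proper_card; rewrite properEneq SB andbT.
by apply: contraNneq BS => ->; rewrite setDv.
Qed.

(** The bounds say that the number of trees is the greedy maximum for [#|V|]. In the second ending
    they come from the state before the replacement, which changes no tree count. *)
Lemma produced_packing (G : graph V) : produced Omega G ->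
  exists v q, [/\ packing Omega v q set0, edges G = red_edges [seq a.2 | a <- q]
    & 1 + \sum_(j < size q) sz j <= #|V| < 1 + \sum_(j < (size q).+1) sz j].
Proof.
case=> [c c0 GE | S F c A j F' cA leA A0 szj cF' GE].
  have [v [q [qA qc _ cardV]]] := reached_packing c0.
  exists v, q; rewrite qc; split=> //; rewrite cardV cards0 addn0 ltn_add2l.
  rewrite -qc size_map leqnn big_ord_recr /= -addn1 leq_add2l ltnW //.
  exact: size_gt1 Omega_list _.
have [B [cB SB cSF AE BE]] := reached_cons cA; rewrite BE in szj cF' GE.
have [v [q [qB qc qj cardV]]] := reached_packing cB.
have ltj : size c < j by apply: replacement_index cSF SB _ szj; rewrite -AE.
exists v, ((j, (B, F')) :: q); split.
- by rewrite -(setDv B); apply: PackCons => //; rewrite qj -leqNgt ltnW.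
- by rewrite GE /= qc.
rewrite /= cardV -addnA leq_add2l ltn_add2l -(size_map snd q) qc.
rewrite !big_ord_recr /=.
move: leA (subset_leq_card SB); rewrite AE /= (cardsDS SB) (card_copy cSF) card_ord.
by move: #|B| (sz _) (sz _) (\sum_(_ < _) _); lia.
Qed.

Lemma packing_graph v q (A : {set V}) : packing Omega v q A ->
  exists G : graph V, edges G = red_edges [seq a.2 | a <- q].
Proof.
move=> qA; have card2 : [forall e in red_edges [seq a.2 | a <- q], #|e| == 2].
  apply/forall_inP=> e; rewrite mem_red_edges has_map => /hasP[a aq ea].
  by rewrite (copy_edge_card2 (packing_copy qA aq) ea).
by exists (Graph card2).
Qed.

Lemma reached_saturate c (A : {set V}) : reached Omega c A ->
  exists c' (B : {set V}), [/\ reached Omega c' B, #|B| < sz (size c') & size c <= size c'].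
Proof.
have [m] := ubnP #|A|; elim: m c A => // m IHm c A; rewrite ltnS => leA cA.
have [? | leszA] := ltnP #|A| (sz (size c)); first by exists c, A.
have [S SA Sc] : exists2 S : {set V}, S \subset A & #|S| = sz (size c).
  have /card_geqP[s [us szs sA]] := leszA.
  exists [set x in s]; first by apply/subsetP=> x; rewrite inE => /sA.
  by rewrite cardsE (card_uniqP us).
have [F cSF] := exists_copy (Omega (size c)) Sc.
have [|c' [B [c'B ltB lec]]] := IHm ((S, F) :: c) (A :\: S) _ (Step2 cA SA cSF).
  apply: leq_trans leA; rewrite (cardsDS SA) Sc.
  by move: leszA (size_ge7 (size c)); move: #|A| (sz _); lia.
by exists c', B; split=> //; apply: ltnW.
Qed.

Lemma exists_produced : 8 <= #|V| -> exists G : graph V, produced Omega G.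
Proof.
move=> V8; have [v _] : exists v, v \in V by apply/card_gt0P; apply: leq_trans V8.
have [c [A [cA ltA _]]] := reached_saturate (Step1 Omega v).
case: c => [|[S F] c] in cA ltA.
  (* Some tree has 7 vertices, so the first has at most 7. With 8 vertices Step 2 is therefore
     carried out at least once, and there is a last tree to replace. *)
  have [j szj] := size_onto (leqnn 7).
  have [v' [q [_ _ _ cardV]]] := reached_packing cA.
  have := size_mono Omega_list (leq0n j); rewrite szj.
  move: V8 ltA; rewrite cardV big_ord0 /= => V8 ltA.
  by move: V8 ltA; move: #|A| (sz 0); lia.
have [A0 | AN0] := eqVneq A set0.
  rewrite A0 in cA; have [v' [q [qA qc _ _]]] := reached_packing cA.
  have [G GE] := packing_graph qA; exists G; apply: (NoneLeft cA).
  by rewrite GE qc.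
have [B [cB SB cSF AE BE]] := reached_cons cA.
have [j szj] : exists j, sz j = #|B|.
  apply: size_onto; apply: leq_trans (size_ge7 (size c)) _.
  by have := subset_leq_card SB; rewrite (card_copy cSF) card_ord.
have [F' cF'] := exists_copy (Omega j) (esym szj).
have [v' [q [qB qc qj cardV]]] := reached_packing cB.
have jq : size c < j by apply: replacement_index cSF SB _ szj; rewrite -AE.
have jq' : j \notin [seq a.1 | a <- q] by rewrite qj -leqNgt ltnW.
have [G GE] := packing_graph (PackCons qB (subxx B) cF' jq').
exists G; apply: (ReplaceLast (j := j) (F' := F') cA) => //; rewrite ?BE //.
by rewrite GE /= qc.
Qed.

End Procedure.

(** * Two-colorings of the complete graph and asymmetric graphs *)

Section EdgeCost.

Variable V : finType.

Lemma complete_automorphism (p : {perm V}) : automorphism (complete V) p.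
Proof.
apply/automorphismP=> x y; rewrite /adj !inE !cards2.
by rewrite (inj_eq perm_inj).
Qed.

Definition class_edges (c : edge_coloring (complete V) 2) (i : 'I_2) : {set {set V}} :=
  [set val e | e in color_class c i].

Lemma class_edges_card2 c i : [forall e in class_edges c i, #|e| == 2].
Proof.
apply/forall_inP=> _ /imsetP[e _ ->].
by have := valP e; rewrite inE.
Qed.

Definition class_graph c i : graph V := Graph (class_edges_card2 c i).

Lemma card_class_graph c i : #|edges (class_graph c i)| = #|color_class c i|.
Proof. exact: card_imset val_inj. Qed.

(** With only two colors, a permutation that preserves one class preserves the other as well. *)
Lemma class_graph_asymmetric c i : distinguishing c -> asymmetric (class_graph c i).
Proof.
move/forallP=> dist; apply/forallP=> p; apply/implyP=> autp.
have /implyP := dist p; apply; rewrite complete_automorphism /=.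
have mem_class e : (val e \in class_edges c i) = (c e == i).
  by rewrite mem_imset ?inE //; apply: val_inj.
apply/forallP=> e; apply/forallP=> e'; apply/implyP=> /eqP e'E.
have : (c e' == i) = (c e == i).
  rewrite -!mem_class e'E.
  have {1}-> : class_edges c i = [set p @: (e : {set V}) | e in class_edges c i].
    by rewrite (eqP autp).
  by rewrite mem_imset //; apply: imset_inj; apply: perm_inj.
have two (a b j : 'I_2) : (a == j) = (b == j) -> a == b.
  by case: a b j => [[|[|//]] ?] [[|[|//]] ?] [[|[|//]] ?].
exact: two.
Qed.

Lemma complete_edge (e : {set V}) :
  #|e| = 2 -> exists e' : edge (complete V), val e' = e.
Proof.
move=> e2; have eC : e \in edges (complete V) by rewrite inE e2.
by exists (Sub e eC); rewrite SubK.
Qed.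

Definition coloring_of (G : graph V) : edge_coloring (complete V) 2 :=
  [ffun e => if val e \in edges G then ord0 else ord_max].

Lemma coloring_of_distinguishing (G : graph V) :
  asymmetric G -> distinguishing (coloring_of G).
Proof.
move/forallP=> asymG; apply/forallP=> p; apply/implyP=> /andP[_ /forallP pres].
have /implyP := asymG p; apply; apply/automorphismP=> x y xy.
have [e eE] := complete_edge (card_edge xy).
have [e' e'E] : exists e' : edge (complete V), val e' = [set p x; p y].
  by apply: complete_edge; rewrite cards2 (inj_eq perm_inj) (adj_neq xy).
have /forallP/(_ e')/implyP := pres e.
rewrite e'E eE imset_set2 eqxx => /(_ isT); rewrite !ffunE e'E eE -!/(adj G _ _) xy.
by case: ifP.
Qed.

Lemma color_class_coloring_of (G : graph V) :
  #|color_class (coloring_of G) ord0| = #|edges G|.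
Proof.
rewrite -card_class_graph; congr #|pred_of_set _|; apply/setP=> e.
apply/imsetP/idP => [[e' + ->] | eG].
  by rewrite inE ffunE; case: ifP.
have [e' e'E] := complete_edge (card_edge eG).
by exists e'; rewrite // inE ffunE e'E eG.
Qed.

Lemma edge_cost_complete (G : graph V) :
  1 < #|V| -> asymmetric G ->
  (forall H : graph V, asymmetric H -> #|edges G| <= #|edges H|) ->
  is_edge_cost (complete V) #|edges G|.
Proof.
move=> V1 asymG minG; have distG := coloring_of_distinguishing asymG.
split; split.
- by exists (coloring_of G).
(* Zero colors cannot color an existing edge, and with one color every transposition preserves the
   coloring. *)
- case=> [|[|//]] [c distc].
    have [x [y [_ _ xy]]] := card_gt1P V1.
    have [|e _] := @complete_edge [set x; y]; first by rewrite cards2 xy.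
    by case: (c e).
  have [x [y [_ _ xy]]] := card_gt1P V1.
  have /implyP := forallP distc (tperm x y); rewrite complete_automorphism /=.
  have -> : preserves (tperm x y) c.
    by apply/forallP=> e; apply/forallP=> e'; rewrite !(ord1 (c _)) eqxx implybT.
  move=> /(_ isT)/eqP/permP/(_ x); rewrite tpermL perm1 => yx.
  by rewrite yx eqxx in xy.
- exists (coloring_of G) => //; rewrite color_class_coloring_of.
  apply/esym/minn_idPl; rewrite -card_class_graph.
  exact/minG/class_graph_asymmetric.
move=> k [c distc ->]; rewrite leq_min -!card_class_graph.
by rewrite !minG //; apply: class_graph_asymmetric.
Qed.

End EdgeCost.

(** * Counting asymmetric trees *)

(** [packing_card] gives [#|V| = #|edges G| + size q + 1], and [asymmetric_edges] with [k = size q]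
    shows that no asymmetric graph has fewer edges. *)
Lemma packing_edge_cost (sz : nat -> nat) (Omega : forall j, graph 'I_(sz j))
    (V : finType) v q (G : graph V) :
  asym_tree_list Omega -> 1 < #|V| -> packing Omega v q set0 ->
  edges G = red_edges [seq a.2 | a <- q] ->
  #|V| < 1 + \sum_(j < (size q).+1) sz j ->
  is_edge_cost (complete V) #|edges G|.
Proof.
move=> Omega_list V1 packed edgesG ltV.
apply: edge_cost_complete => //; first exact: packing_asymmetric packed edgesG.
move=> H asymH; have := asymmetric_edges Omega_list asymH ltV.
by rewrite (packing_card Omega_list packed) -edgesG cards0 addn0 -addnA addn1 leq_add2r.
Qed.

Section TreeRepresentatives.

Variable m : nat.

Definition asym_trees : {set graph 'I_m} := [set G | tree G && asymmetric G].

Definition asym_tree_classes : {set {set graph 'I_m}} :=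
  equivalence_partition (@isomorphic 'I_m 'I_m) asym_trees.

Definition asym_tree_reps : seq (graph 'I_m) :=
  enum (transversal asym_tree_classes asym_trees).

Lemma isomorphic_equivalence :
  {in asym_trees & &, equivalence_rel (@isomorphic 'I_m 'I_m)}.
Proof.
move=> G H K _ _ _; split=> [|GH]; first exact: isomorphic_refl.
by apply/idP/idP; apply: isomorphic_trans => //; apply: isomorphic_sym.
Qed.

Let classesP : partition asym_tree_classes asym_trees :=
  equivalence_partitionP isomorphic_equivalence.

Let transP := transversalP classesP.

Lemma size_asym_tree_reps : size asym_tree_reps = num_asym_trees m.
Proof. by rewrite -cardE (card_transversal transP). Qed.

Lemma mem_asym_tree_reps (G : graph 'I_m) : G \in asym_tree_reps -> tree G && asymmetric G.
Proof. by rewrite mem_enum => /(subsetP (transversal_sub transP)); rewrite inE. Qed.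

Lemma asym_tree_reps_inj (G H : graph 'I_m) :
  G \in asym_tree_reps -> H \in asym_tree_reps -> isomorphic G H -> G = H.
Proof.
rewrite !mem_enum => GX HX isoGH.
have sub := subsetP (transversal_sub transP).
apply: (pblock_inj transP) => //; apply/eqP.
have /and3P[/eqP coverP triv _] := classesP.
rewrite eq_pblock ?coverP ?sub //.
by rewrite (pblock_equivalence_partition isomorphic_equivalence) ?sub.
Qed.

Lemma asym_tree_repsP (G : graph 'I_m) : tree G -> asymmetric G ->
  exists2 H, H \in asym_tree_reps & isomorphic G H.
Proof.
move=> treeG asymG; have GD : G \in asym_trees by rewrite inE treeG.
have /and3P[/eqP coverP triv _] := classesP.
have PG : pblock asym_tree_classes G \in asym_tree_classes.
  by apply: pblock_mem; rewrite coverP.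
exists (transversal_repr G (transversal asym_tree_classes asym_trees)
          (pblock asym_tree_classes G)).
  by rewrite mem_enum (repr_mem_transversal transP).
rewrite -(pblock_equivalence_partition isomorphic_equivalence) //.
  exact: repr_mem_pblock transP _ _ PG.
by apply: (subsetP (transversal_sub transP)); apply: repr_mem_transversal transP _ _ PG.
Qed.

End TreeRepresentatives.

Lemma num_asym_trees_gt0 m : 7 <= m -> 0 < num_asym_trees m.
Proof.
move=> m7; have [H HX _] := asym_tree_repsP (spider_tree m7) (spider_asymmetric m7).
by rewrite -size_asym_tree_reps; case: (asym_tree_reps m) HX.
Qed.

Lemma ord1_tree (G : graph 'I_1) : tree G /\ asymmetric G.
Proof.
have no_adj x y : adj G x y = false.
  by apply/negbTE/negP=> /adj_neq; rewrite (ord1 x) (ord1 y) eqxx.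
split; last first.
  by apply/forallP=> p; apply/implyP=> _; apply/eqP/permP=> x; rewrite [LHS]ord1 [RHS]ord1.
apply/andP; split.
  by apply: (@connected_parent _ _ ord0 (fun=> 0) id) => x; rewrite (ord1 x) eqxx.
by apply: (@forest_parent _ _ (fun=> 0) id) => x y; rewrite no_adj.
Qed.

Lemma num_asym_trees1 : num_asym_trees 1 = 1.
Proof.
have [H HX _] := asym_tree_repsP (ord1_tree (complete 'I_1)).1 (ord1_tree _).2.
rewrite -size_asym_tree_reps; apply/eqP; rewrite eqn_leq; apply/andP; split; last first.
  by case: (asym_tree_reps 1) HX.
rewrite -/(size [:: H]); apply: uniq_leq_size (enum_uniq _) _ => K KX.
rewrite inE; apply/eqP; apply: asym_tree_reps_inj => //.
by apply: isomorphic_card1; rewrite card_ord.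
Qed.

(* All asymmetric trees, the one-vertex tree included, are numbered by size:
   those on [m] vertices get the numbers from [tree_count m.-1] to
   [(tree_count m).-1]. *)
Definition tree_count (m : nat) : nat := \sum_(1 <= i < m.+1) num_asym_trees i.

Lemma tree_count0 : tree_count 0 = 0.
Proof. by rewrite /tree_count big_geq. Qed.

Lemma tree_countS m : tree_count m.+1 = tree_count m + num_asym_trees m.+1.
Proof. by rewrite /tree_count big_nat_recr. Qed.

Lemma tree_count_mono : {homo tree_count : i j / i <= j}.
Proof. by apply: homo_leq leq_trans _ => // i; rewrite tree_countS leq_addr. Qed.

(** From size 7 on, every size contributes at least its spider. *)
Lemma tree_count_unbounded t : exists m, t < tree_count m.
Proof.
exists (t + 7); elim: t => [|t IHt]; rewrite ?addSn tree_countS.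
  by rewrite ltn_addl ?num_asym_trees_gt0.
by apply: leq_trans (leq_add IHt (num_asym_trees_gt0 _)); rewrite ?addn1 // ltnW // ltnS leq_addl.
Qed.

Definition nth_size (t : nat) : nat := ex_minn (tree_count_unbounded t).

Lemma nth_sizeP t : exists m, [/\ nth_size t = m.+1, tree_count m <= t
  & t < tree_count m.+1].
Proof.
rewrite /nth_size; case: ex_minnP => -[|m] ltm minm; first by rewrite tree_count0 in ltm.
by exists m; split=> //; rewrite leqNgt; apply/negP=> /minm; rewrite ltnn.
Qed.

Lemma nth_size_eq t m : tree_count m <= t < tree_count m.+1 -> nth_size t = m.+1.
Proof.
case/andP=> lem ltm; have [l [-> lel ltl]] := nth_sizeP t; congr _.+1.
have [/tree_count_mono | /tree_count_mono | //] := ltngtP l m.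
  by move/(leq_trans ltl); rewrite ltnNge lem.
by move/(leq_trans ltm); rewrite ltnNge lel.
Qed.

Definition nth_tree (t : nat) : graph 'I_(nth_size t) :=
  nth (spider _) (asym_tree_reps (nth_size t)) (t - tree_count (nth_size t).-1).

(** The type of [nth_tree t] depends on [nth_size t], so the two trees cannot be equated directly.
    Being isomorphic to a given graph makes sense on both sides, and the size can then be
    generalized. *)
Lemma nth_tree_rep t m : tree_count m <= t < tree_count m.+1 ->
  forall n (H : graph 'I_n), isomorphic H (nth_tree t) =
    isomorphic H (nth (spider _) (asym_tree_reps m.+1) (t - tree_count m)).
Proof.
move=> /nth_size_eq tm n H; rewrite /nth_tree.
have gen l : l = m.+1 ->
    isomorphic H (nth (spider _) (asym_tree_reps l) (t - tree_count l.-1)) =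
    isomorphic H (nth (spider _) (asym_tree_reps m.+1) (t - tree_count m)).
  by move=> ->.
exact: gen.
Qed.

(** The shift to [j.+1] skips number 0, which is the one-vertex tree since [tree_count 1 = 1]. *)
Lemma nth_tree_list : @asym_tree_list (fun j => nth_size j.+1) (fun j => nth_tree j.+1).
Proof.
have count1 : tree_count 1 = 1 by rewrite tree_countS tree_count0 num_asym_trees1.
split=> [j | m G m1 treeG asymG | i j ltij].
- have [m [szE lem ltm]] := nth_sizeP j.+1.
  have : nth_tree j.+1 \in asym_tree_reps (nth_size j.+1).
    apply: mem_nth; rewrite size_asym_tree_reps szE /=.
    by rewrite ltn_subLR // -tree_countS.
  case/mem_asym_tree_reps/andP=> treeT asymT; split=> //.
  rewrite szE; case: m ltm {lem szE} => //; by rewrite count1.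
- case: m m1 G treeG asymG => // m m1 G treeG asymG.
  have [H HX isoGH] := asym_tree_repsP treeG asymG.
  have HXs : index H (asym_tree_reps m.+1) < num_asym_trees m.+1.
    by rewrite -size_asym_tree_reps index_mem.
  have count_gt0 : 0 < tree_count m by rewrite -count1; apply: tree_count_mono.
  pose t := tree_count m + index H (asym_tree_reps m.+1).
  have tE : t.-1.+1 = t by rewrite prednK // /t addn_gt0 count_gt0.
  have tm : tree_count m <= t < tree_count m.+1.
    by rewrite leq_addr tree_countS ltn_add2l.
  exists t.-1; split; first by rewrite tE (nth_tree_rep tm) addKn nth_index.
  move=> j isoGj; apply: succn_inj; rewrite tE.
  have jm : tree_count m <= j.+1 < tree_count m.+1.
    have [l [szl lel ltl]] := nth_sizeP j.+1.
    have := isomorphic_card isoGj; rewrite !card_ord szl => -[->].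
    by rewrite lel ltl.
  move: isoGj; rewrite (nth_tree_rep jm).
  case/andP: jm => lem; rewrite tree_countS -ltn_subLR // => ltj isoGj.
  rewrite -(subnKC lem); congr (_ + _).
  have KX : nth (spider _) (asym_tree_reps m.+1) (j.+1 - tree_count m) \in asym_tree_reps m.+1.
    by rewrite mem_nth // size_asym_tree_reps.
  rewrite (asym_tree_reps_inj HX KX) ?index_uniq ?enum_uniq ?size_asym_tree_reps //.
  exact: isomorphic_trans (isomorphic_sym isoGH) isoGj.
rewrite /nth_size; case: ex_minnP => k _ mink; case: ex_minnP => l ltl _.
by apply: mink; apply: leq_trans ltl; rewrite ltnS ltnW.
Qed.

(** * Total sizes of initial segments and the decomposition of [n] *)

Definition vertex_count (m : nat) : nat := \sum_(1 <= i < m.+1) i * num_asym_trees i.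

Lemma vertex_countS m : vertex_count m.+1 = vertex_count m + m.+1 * num_asym_trees m.+1.
Proof. by rewrite /vertex_count big_nat_recr. Qed.

Lemma vertex_count_mono : {homo vertex_count : i j / i <= j}.
Proof. by apply: homo_leq leq_trans _ => // i; rewrite vertex_countS leq_addr. Qed.

Lemma sum_nth_size m a : a <= num_asym_trees m.+1 ->
  \sum_(t < tree_count m + a) nth_size t = vertex_count m + a * m.+1.
Proof.
have step k b : b <= num_asym_trees k.+1 ->
    \sum_(t < tree_count k + b) nth_size t =
    \sum_(t < tree_count k) nth_size t + b * k.+1.
  elim: b => [_ | b IHb ltb]; first by rewrite !addn0.
  rewrite addnS big_ord_recr /= (IHb (ltnW ltb)) (@nth_size_eq _ k).
    by rewrite mulSn -addnA; congr (_ + _); apply: addnC.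
  by rewrite leq_addr tree_countS ltn_add2l.
move=> /step->; congr (_ + _).
elim: m {a} => [|m IHm]; first by rewrite tree_count0 big_ord0 /vertex_count big_geq.
by rewrite tree_countS step // IHm vertex_countS mulnC.
Qed.

Lemma decomposition_unique n N w r N' w' r' :
  decomposition n N w r -> decomposition n N' w' r' -> [/\ N' = N, w' = w & r' = r].
Proof.
rewrite /decomposition -!/(vertex_count _).
move=> [/andP[leN ltN] nE _ rN] [/andP[leN' ltN'] nE' _ rN'].
have NE : N' = N.
  have [/vertex_count_mono le | /vertex_count_mono le | //] := ltngtP N' N.
    by have := leq_trans ltN' (leq_trans le leN); rewrite ltnn.
  by have := leq_trans ltN (leq_trans le leN'); rewrite ltnn.
subst N'; have wr : w' * N.+1 + r' = w * N.+1 + r.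
  by apply: (@addnI (vertex_count N)); rewrite !addnA -nE -nE'.
have wE : w' = w.
  by have := congr1 (divn^~ N.+1) wr; rewrite !divnMDl // !divn_small // !addn0.
by split=> //; move: wr; rewrite wE => /addnI.
Qed.

Lemma exists_decomposition n : 0 < n -> exists N w r, 0 < N /\ decomposition n N w r.
Proof.
move=> n0; rewrite /decomposition.
have exN : exists N, n < vertex_count N.+1.
  (* A single tree on [n + 8] vertices already exceeds [n], and the spider is one. *)
  exists (n + 7); rewrite vertex_countS.
  apply: leq_trans (leq_addl _ _); apply: leq_trans (leq_pmulr _ _); first lia.
  by rewrite num_asym_trees_gt0 // leqW // leq_addl.
case: (ex_minnP exN) => N ltN minN.
have leN : vertex_count N <= n.
  case: N minN {ltN} => [|N] minN; first by rewrite /vertex_count big_geq.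
  by rewrite leqNgt; apply/negP=> /minN; rewrite ltnn.
have N0 : 0 < N.
  case: N ltN {minN leN} => //; rewrite vertex_countS /vertex_count big_geq //.
  by rewrite num_asym_trees1; lia.
exists N, ((n - vertex_count N) %/ N.+1), ((n - vertex_count N) %% N.+1).
split=> //; split; rewrite ?leN ?ltn_mod //.
  by rewrite -addnA -divn_eq subnKC.
by rewrite ltn_divLR // mulnC ltn_subLR // -vertex_countS.
Qed.

Theorem theorem3p2 (n : nat) (hn : 8 <= n) :
  (forall (sz : nat -> nat) (Omega : forall j, graph 'I_(sz j)),
     asym_tree_list Omega ->
     (exists F : graph 'I_n, produced Omega F) /\
     (forall F : graph 'I_n, produced Omega F ->
        [/\ forest F, asymmetric F, #|cover (edges F)| = n - 1
          & is_edge_cost (complete 'I_n) #|edges F|])) /\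
  (exists N w r : nat,
     [/\ decomposition n N w r,
         forall N' w' r' : nat, decomposition n N' w' r' ->
           [/\ N' = N, w' = w & r' = r]
       & is_edge_cost (complete 'I_n)
           (n - \sum_(1 <= i < N.+1) num_asym_trees i - w)]).
Proof.
have V8 : 8 <= #|'I_n| by rewrite card_ord.
have V1 : 1 < #|'I_n| by apply: leq_trans V8.
split=> [sz Omega Omega_list | ].
  split=> [|F /(produced_packing Omega_list)[v [q [packed FE /andP[_ ltV]]]]].
    exact: exists_produced.
  split; [exact: packing_forest packed FE | exact: packing_asymmetric packed FE | |].
    by rewrite (packing_cover Omega_list packed FE) card_ord.
  exact: packing_edge_cost packed FE ltV.
have [|N [w [r [N0 dec]]]] := @exists_decomposition n; first by apply: leq_trans hn.
exists N, w, r; split=> // [N' w' r' | ]; first exact: decomposition_unique.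
have [G /(produced_packing nth_tree_list)[v [q [packed GE /andP[leV ltV]]]]] :=
  exists_produced nth_tree_list V8.
have cost := packing_edge_cost nth_tree_list V1 packed GE ltV.
have := packing_card nth_tree_list packed; rewrite -GE cards0 addn0 card_ord => nE.
have sumE k : 1 + \sum_(j < k) nth_size j.+1 = \sum_(t < k.+1) nth_size t.
  rewrite big_ord_recl; congr (_ + _); apply/esym/nth_size_eq.
  by rewrite tree_countS tree_count0 num_asym_trees1.
rewrite !sumE card_ord in leV ltV.
have sum_mono a b : a <= b -> \sum_(t < a) nth_size t <= \sum_(t < b) nth_size t.
  by move=> leab; rewrite -!(big_mkord xpredT nth_size) (big_cat_nat (leq0n a) leab) leq_addr.
case: dec; rewrite -!/(vertex_count _) => _ nE' ltw ltr.
have sum_lo := sum_nth_size (ltnW ltw); have sum_hi := sum_nth_size ltw.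
(* Both sides are the largest number of initial trees, the one-vertex tree included, whose total
   size is at most [n]: one more tree after [tree_count N + w] would add [N + 1 > r] vertices. *)
have qE : (size q).+1 = tree_count N + w.
  apply/eqP; rewrite eqn_leq; apply/andP; split; rewrite leqNgt; apply/negP=> /sum_mono.
    by rewrite -addnS sum_hi mulSn; lia.
  by rewrite sum_lo; lia.
suff -> : n - \sum_(1 <= i < N.+1) num_asym_trees i - w = #|edges G| by [].
by rewrite -/(tree_count N); lia.
Qed.
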